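(* Let $B<0$ and consider the arc-length parametrized curves $X:\mathbf R\to\mathbf C$ satisfying $$B\langle X,N\rangle=k\quad\text{on }\mathbf R,$$ other than straight lines through the origin. (i) Each of these curves is contained in an annulus $\{r_{min}\le|z|\le r_{max}\}$ around the origin and consists of a series of identical excursions between the two boundaries of the annulus. The curvature never changes sign and (for the orientation in which it is positive) is an increasing function of the radius $r=|X|$. The inner and outer radii satisfy $$r_{min}e^{\frac{Br_{min}^2}{2}}=r_{max}e^{\frac{Br_{max}^2}{2}}$$ and take on every value in $(0,\tfrac1{\sqrt{-B}}]$ and $[\tfrac1{\sqrt{-B}},\infty)$, respectively. (ii) The curves form a one-dimensional family parametrized by $r_{min}$ (for each $r_{min}\in(0,\tfrac1{\sqrt{-B}}]$ there is exactly one such curve up to rotation about the origin and reparametrization) and are divided into two sets: 1) Closed curves, i.e. immersed $\mathbf S^1$. In addition to the circle (of radius $\frac1{\sqrt{-B}}$ centered at the origin), there is a curve with rotation number $p$ which touches each boundary of the annulus $q$ times for each pair of mutually prime positive integers $p,q$ such that $\frac12<\frac pq<\frac{\sqrt2}{2}$. 2) Curves whose image is dense in the annulus. (iii) Under the curve shortening flow these curves shrink with scaling function $g(t)=\sqrt{2Bt+1}$, i.e. $\hat X(u,t)=\sqrt{2Bt+1}\,X(u)$, $0\le t<-\frac1{2B}$, is the curve shortening flow of $X$ (up to tangential diffeomorphisms), until they disappear into the origin at time $t=-\frac1{2B}$.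
   Context: The plane is identified with $\mathbf C$, with the real inner product $\langle z,w\rangle=\mathrm{Re}(z\bar w)$. Curves are smooth, defined on all of $\mathbf R$ and parametrized by arc length ($|X'|=1$). $T=X'$ is the unit tangent, $N=iT$ the leftward pointing normal, and $k=\langle X'',N\rangle$ the signed curvature. A family $\hat X(u,t)$ of immersed curves with $\hat X(u,0)=X(u)$ is the curve shortening flow of $X$ (up to tangential diffeomorphisms) if $\langle\partial_t\hat X(u,t),N(u,t)\rangle=k(u,t)$ for all $(u,t)$, where $N(u,t)$ and $k(u,t)$ are the leftward normal and signed curvature of $u\mapsto\hat X(u,t)$. An excursion is a piece of the curve going from the outer boundary circle of the annulus to the inner boundary circle and back out to the outer boundary circle; ''identical'' means that successive excursions are obtained from one another by a fixed rotation about the origin. For the circle of radius $\frac{1}{\sqrt{-B}}$ centered at the origin the annulus degenerates, $r_{min}=r_{max}=\frac1{\sqrt{-B}}$. The rotation number of a closed immersed curve is the total change of its tangent angle over one full traversal, divided by $2\pi$ (for the orientation with positive curvature); the number of times the curve touches each boundary is counted over one full traversal. *)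

(* Defs.v *)
From Stdlib Require Import Reals Lra List ZArith.
From Coquelicot Require Import Coquelicot.
Open Scope R_scope.

Definition inner (z w : C) : R := Re (z * Cconj w)%C.

Definition smooth (X : R -> C) : Prop :=
  forall (n : nat) (s : R),
    ex_derive_n (fun u => Re (X u)) n s /\ ex_derive_n (fun u => Im (X u)) n s.

Definition velocity (X : R -> C) (s : R) : C :=
  (Derive (fun u => Re (X u)) s, Derive (fun u => Im (X u)) s).

Definition immersed (X : R -> C) : Prop :=
  smooth X /\ forall s, velocity X s <> RtoC 0.

Definition unit_speed (X : R -> C) : Prop :=
  smooth X /\ forall s, Cmod (velocity X s) = 1.

(* Tangent, normal and curvature of an immersed curve with arbitrary
   parametrization: the slices of the flow below are not parametrized by arc
   length.  For unit speed they are X', iX' and <X'', iX'>, see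
   [tangent_unit_speed], [normal_unit_speed] and [curvature_unit_speed]. *)
Definition tangent (X : R -> C) (s : R) : C :=
  (velocity X s / RtoC (Cmod (velocity X s)))%C.

Definition normal (X : R -> C) (s : R) : C := (Ci * tangent X s)%C.

Definition curvature (X : R -> C) (s : R) : R :=
  inner (velocity (velocity X) s) (normal X s) / Cmod (velocity X s) ^ 2.

Lemma tangent_unit_speed (X : R -> C) (s : R) :
  unit_speed X -> tangent X s = velocity X s.
Proof.
intros [_ H]; unfold tangent; rewrite H.
destruct (velocity X s) as [a b]; apply injective_projections; simpl; field.
Qed.

Lemma normal_unit_speed (X : R -> C) (s : R) :
  unit_speed X -> normal X s = (Ci * velocity X s)%C.
Proof.
intros H; unfold normal; rewrite (tangent_unit_speed X s H); reflexivity.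
Qed.

Lemma curvature_unit_speed (X : R -> C) (s : R) :
  unit_speed X ->
  curvature X s = inner (velocity (velocity X) s) (Ci * velocity X s)%C.
Proof.
intros H; unfold curvature; rewrite (normal_unit_speed X s H), (proj2 H s).
field.
Qed.

Definition line_through_origin (X : R -> C) : Prop :=
  exists e : C, e <> RtoC 0 /\
    forall z : C, (exists s, X s = z) <-> (exists a : R, z = (RtoC a * e)%C).

Definition circle_at_origin (rho : R) (X : R -> C) : Prop :=
  forall z : C, (exists s, X s = z) <-> Cmod z = rho.

Definition shrinker (B : R) (X : R -> C) : Prop :=
  unit_speed X /\
  (forall s, B * inner (X s) (normal X s) = curvature X s) /\
  ~ line_through_origin X.

(* The smallest closed annulus around the origin containing the curve is
   {rmin <= |z| <= rmax}, and the curve reaches both boundary circles. *)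
Definition annulus_radii (X : R -> C) (rmin rmax : R) : Prop :=
  (forall s, rmin <= Cmod (X s) <= rmax) /\
  (exists s, Cmod (X s) = rmin) /\ (exists s, Cmod (X s) = rmax).

Definition excursion (X : R -> C) (rmin rmax a b : R) : Prop :=
  exists m : R, a < m < b /\
    Cmod (X a) = rmax /\ Cmod (X m) = rmin /\ Cmod (X b) = rmax /\
    forall s, a < s < b -> s <> m -> rmin < Cmod (X s) < rmax.

(* The parameter line is cut into consecutive intervals of common length [l],
   each of them an excursion; [w] is the rotation carrying each excursion to
   the next one. *)
Definition identical_excursions (X : R -> C) (rmin rmax : R) : Prop :=
  exists (s0 l : R) (w : C), 0 < l /\ Cmod w = 1 /\
    (forall j : Z,
       excursion X rmin rmax (s0 + IZR j * l) (s0 + (IZR j + 1) * l)) /\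
    (forall s, X (s + l) = (w * X s)%C).

Definition reverse (X : R -> C) (s : R) : C := X (- s).

Definition positively_curved (X : R -> C) : Prop := forall s, 0 < curvature X s.

Definition positive_orientation (X Y : R -> C) : Prop :=
  (Y = X \/ Y = reverse X) /\ positively_curved Y.

Definition curvature_increasing (X : R -> C) (rmin rmax : R) : Prop :=
  exists f : R -> R,
    (forall r1 r2, rmin <= r1 -> r1 < r2 -> r2 <= rmax -> f r1 < f r2) /\
    (forall s, curvature X s = f (Cmod (X s))).

(* Changes of parameter between arc length parametrizations are the maps
   s |-> e s + a with e = 1 or e = -1. *)
Definition congruent (X Y : R -> C) : Prop :=
  exists (w : C) (e a : R), Cmod w = 1 /\ (e = 1 \/ e = -1) /\
    forall s, Y s = (w * X (e * s + a)%R)%C.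

Definition period (X : R -> C) (L : R) : Prop :=
  0 < L /\ forall s, X (s + L) = X s.

Definition closed_curve (X : R -> C) : Prop := exists L, period X L.

Definition minimal_period (X : R -> C) (L : R) : Prop :=
  period X L /\ forall L', period X L' -> L <= L'.

Definition rotation_number (X : R -> C) (L p : R) : Prop :=
  exists theta : R -> R,
    (forall s, continuous theta s) /\
    (forall s, tangent X s = (cos (theta s), sin (theta s))) /\
    theta L - theta 0 = 2 * PI * p.

(* Visits to the circle |z| = rho are counted by parameter values in one
   traversal [0, L), not by points of the image. *)
Definition touches (X : R -> C) (L rho : R) (q : nat) : Prop :=
  exists l : list R, NoDup l /\ length l = q /\
    forall s, In s l <-> (0 <= s < L /\ Cmod (X s) = rho).

Definition closed_of_type (X : R -> C) (p q : nat) : Prop :=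
  exists (Y : R -> C) (L rmin rmax : R),
    positive_orientation X Y /\ minimal_period Y L /\
    rotation_number Y L (INR p) /\
    annulus_radii Y rmin rmax /\ touches Y L rmin q /\ touches Y L rmax q.

Definition admissible (p q : nat) : Prop :=
  (0 < p)%nat /\ (0 < q)%nat /\ Nat.gcd p q = 1%nat /\
  1 / 2 < INR p / INR q < sqrt 2 / 2.

Definition dense_in_annulus (X : R -> C) : Prop :=
  exists rmin rmax : R, annulus_radii X rmin rmax /\
    forall z : C, rmin <= Cmod z <= rmax ->
      forall eps, 0 < eps -> exists s, Cmod (X s - z)%C < eps.

(* Curve shortening flow up to tangential diffeomorphisms, on 0 <= t < tmax. *)
Definition curve_shortening_flow
    (X : R -> C) (Xhat : R -> R -> C) (tmax : R) : Prop :=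
  (forall u, Xhat u 0 = X u) /\
  forall t, 0 <= t < tmax ->
    immersed (fun u => Xhat u t) /\
    forall u,
      ex_derive (fun t' => Re (Xhat u t')) t /\
      ex_derive (fun t' => Im (Xhat u t')) t /\
      inner (velocity (fun t' => Xhat u t') t) (normal (fun v => Xhat v t) u)
        = curvature (fun v => Xhat v t) u.

Definition vanishes_at (Xhat : R -> R -> C) (tmax : R) : Prop :=
  forall eps, 0 < eps -> exists delta, 0 < delta /\
    forall u t, tmax - delta < t < tmax -> Cmod (Xhat u t) < eps.

(* Main.v *)
(* In the rescaled arc length sqrt(-B) s, put h = k / sqrt(-B) and
   sigma = sqrt(-B) <X, T>.  Then h' = h sigma, sigma' = 1 - h ^ 2, the tangent
   angle theta has theta' = h, and sigma ^ 2 + h ^ 2 - 2 log h = A ^ 2 + 1 is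
   conserved and equal to -B |X| ^ 2 - 2 log h.  So z = log h is a particle in a
   potential well, of energy A ^ 2 / 2; writing sqrt(exp (2 z) - 1 - 2 z), with
   the sign of z, as A sin p and sigma as A cos p turns all orbits into a phase p
   with dt/dp and dtheta/dp continuous, positive and 2 pi periodic, and
   log h = zeta (A sin p) for a fixed diffeomorphism zeta of the line.  An
   excursion is one period of p; its turning Theta(A) is the integral of
   dtheta/dp.  The curve is closed when Theta / (2 pi) is rational, and dense in
   its annulus otherwise.

   In the variable theta, h sigma and h ^ (1/3) sigma solve v'' + q v = 0 with
   q < 4 and q >= 2 respectively, and both vanish exactly at the radial extrema,
   which are Theta / 2 apart; Sturm comparison gives pi < Theta < sqrt 2 pi.
   Since Theta is continuous with value sqrt 2 pi at A = 0 and comes arbitrarily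
   close to pi, it takes every value in between. *)
Require Import Defs.
From Stdlib Require Import Reals Lra List ZArith.
From Coquelicot Require Import Coquelicot.
From Stdlib Require Import Lia FinFun ClassicalEpsilon FunctionalExtensionality.
Open Scope R_scope.

(** * Calculus on the real line *)

(** The usual formula for the turning integrates between the turning points of the well: the
    integrand has inverse square root singularities there, and the ends of the interval move with
    the energy. The phase p removes both defects. Theta becomes the integral over the fixed interval
    [0, 2 pi] of a continuous function of A sin p, so continuity in A follows from uniform
    continuity, and A = 0, the circle, is an ordinary value although it has no excursions. The
    solutions are explicit and global in time; differential equations are needed only for
    uniqueness, where conservation of energy bounds h and sigma and Gronwall applies.

    Values near pi come from large A: where sin p > 0, dtheta/dp is at most 1 and contributes at
    most pi to a period, while where sin p < 0 it is at most 2 / (A |sin p|).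

    A period of the curve preserves the times of minimal radius, so it consists of whole excursions.
    Hence closedness and density are questions about the subgroup of the line generated by Theta and
    2 pi. *)

Ltac rewrite_Derive H :=
  match type of H with
  | is_derive _ _ ?l =>
      match goal with
      | |- context [Derive ?g ?y] =>
          replace (Derive g y) with l by (symmetry; apply is_derive_unique, H)
      end
  end.

Lemma derive_le_slope (f df : R -> R) (a b c : R) :
  a <= b ->
  (forall x, a <= x <= b -> is_derive f x (df x)) ->
  (forall x, a < x < b -> df x <= c) ->
  f b - f a <= c * (b - a).
Proof.
intros [Hab | <-] Hd Hc; [| lra].
destruct (MVT_cor2 f df a b Hab) as [x [-> Hx]].
  intros x Hx; apply is_derive_Reals, Hd, Hx.
apply Rmult_le_compat_r; [lra | apply Hc, Hx].
Qed.

Lemma derive_ge_slope (f df : R -> R) (a b c : R) :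
  a <= b ->
  (forall x, a <= x <= b -> is_derive f x (df x)) ->
  (forall x, a < x < b -> c <= df x) ->
  c * (b - a) <= f b - f a.
Proof.
intros [Hab | <-] Hd Hc; [| lra].
destruct (MVT_cor2 f df a b Hab) as [x [-> Hx]].
  intros x Hx; apply is_derive_Reals, Hd, Hx.
apply Rmult_le_compat_r; [lra | apply Hc, Hx].
Qed.

Lemma derive_pos_lt (f df : R -> R) (a b : R) :
  a < b ->
  (forall x, a <= x <= b -> is_derive f x (df x)) ->
  (forall x, a < x < b -> 0 < df x) ->
  f a < f b.
Proof.
intros Hab Hd Hc.
destruct (MVT_cor2 f df a b Hab) as [x [He Hx]].
  intros x Hx; apply is_derive_Reals, Hd, Hx.
pose proof (Rmult_lt_0_compat (df x) (b - a) (Hc x Hx)); lra.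
Qed.

Lemma derive_0_const (f : R -> R) :
  (forall x, is_derive f x 0) -> forall x y, f x = f y.
Proof.
intros H x y.
pose proof (fun a b h => derive_le_slope f (fun _ => 0) a b 0 h
  (fun x _ => H x) (fun _ _ => Rle_refl 0)) as Hle.
pose proof (fun a b h => derive_ge_slope f (fun _ => 0) a b 0 h
  (fun x _ => H x) (fun _ _ => Rle_refl 0)) as Hge.
destruct (Rle_or_lt x y) as [h | h].
  specialize (Hle x y h); specialize (Hge x y h); lra.
specialize (Hle y x (Rlt_le _ _ h)); specialize (Hge y x (Rlt_le _ _ h)); lra.
Qed.

(** The weight exp (- c s) makes D nonincreasing forward in time, and exp (c s) makes it
    nondecreasing on negative times. Starting from 0, a nonnegative D cannot leave 0 in either
    direction. *)
Lemma gronwall_zero (D d : R -> R) (c : R) :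
  (forall s, 0 <= D s) ->
  (forall s, is_derive D s (d s)) ->
  (forall s, Rabs (d s) <= c * D s) ->
  D 0 = 0 -> forall s, D s = 0.
Proof.
intros Hpos Hd Hc H0 s.
assert (Hb : forall s, - (c * D s) <= d s <= c * D s)
  by (intro u; apply Rabs_le_between, Hc).
destruct (Rle_or_lt 0 s) as [h | h].
- pose proof (derive_le_slope (fun u => D u * exp (- c * u))
    (fun u => (d u - c * D u) * exp (- c * u)) 0 s 0 h) as H.
  cbv beta in H; rewrite H0 in H.
  assert (D s * exp (- c * s) <= 0).
    enough (D s * exp (- c * s) - 0 * exp (- c * 0) <= 0 * (s - 0)) by lra.
    apply H; intros x _.
    + auto_derive; [exists (d x); apply Hd |].
      rewrite_Derive (Hd x); ring.
    + specialize (Hb x); pose proof (exp_pos (- c * x)).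
      apply Rmult_le_0_r; lra.
  pose proof (exp_pos (- c * s)); specialize (Hpos s); nra.
- pose proof (derive_ge_slope (fun u => D u * exp (c * u))
    (fun u => (d u + c * D u) * exp (c * u)) s 0 0 (Rlt_le _ _ h)) as H.
  cbv beta in H; rewrite H0 in H.
  assert (D s * exp (c * s) <= 0).
    enough (0 * (0 - s) <= 0 * exp (c * 0) - D s * exp (c * s)) by lra.
    apply H; intros x _.
    + auto_derive; [exists (d x); apply Hd |].
      rewrite_Derive (Hd x); ring.
    + specialize (Hb x); pose proof (exp_pos (c * x)).
      apply Rmult_le_pos; lra.
  pose proof (exp_pos (c * s)); specialize (Hpos s); nra.
Qed.

(** Chosen classically so that it is a total function; surjectivity of [f] enters only in the
    lemmas, as [f_onto]. *)
Definition inverse (f : R -> R) (y : R) : R :=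
  epsilon (inhabits 0) (fun x => f x = y).

Section Inverse_function.

Context (f df : R -> R).
Context (f_derive : forall x, is_derive f x (df x)).
Context (df_pos : forall x, 0 < df x).
Context (f_onto : forall y, exists x, f x = y).

Lemma derive_pos_increasing (x y : R) : x < y -> f x < f y.
Proof. intros h; apply (derive_pos_lt f df); auto. Qed.

Lemma derive_pos_inj (x y : R) : f x = f y -> x = y.
Proof.
intros h; destruct (Rtotal_order x y) as [H | [H | H]]; [| exact H |];
  apply derive_pos_increasing in H; lra.
Qed.

Lemma inverse_right (y : R) : f (inverse f y) = y.
Proof. apply (epsilon_spec (inhabits 0) (fun x => f x = y)), f_onto. Qed.

Lemma inverse_left (x : R) : inverse f (f x) = x.
Proof. apply derive_pos_inj, inverse_right. Qed.

Lemma inverse_increasing (x y : R) : x < y -> inverse f x < inverse f y.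
Proof.
intros h; destruct (Rtotal_order (inverse f x) (inverse f y)) as [H | [H | H]];
  [exact H | apply (f_equal f) in H | apply derive_pos_increasing in H];
  rewrite !inverse_right in H; lra.
Qed.

Lemma inverse_continuous (y : R) : continuous (inverse f) y.
Proof.
apply continuity_pt_filterlim.
apply (Ranalysis5.continuity_pt_recip_interv f (inverse f)
  (inverse f (y - 1)) (inverse f (y + 1))).
- apply inverse_increasing; lra.
- intros; now apply derive_pos_increasing.
- intros; apply inverse_right.
- intros x H1 H2; rewrite inverse_right in H1, H2.
  split.
  + destruct H1 as [H1 | <-]; [left; now apply inverse_increasing | lra].
  + destruct H2 as [H2 | ->]; [left; now apply inverse_increasing | lra].
- intros; apply derivable_continuous_pt; exists (df a); apply is_derive_Reals, f_derive.
- rewrite !inverse_right; lra.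
Qed.

Lemma inverse_derive (y : R) : is_derive (inverse f) y (/ df (inverse f y)).
Proof.
assert (Hd : forall x, derivable_pt f x)
  by (intros x; exists (df x); apply is_derive_Reals, f_derive).
assert (Hi : inverse f (y - 1) <= inverse f y <= inverse f (y + 1))
  by (split; left; apply inverse_increasing; lra).
assert (Hv : derive_pt f (inverse f y) (Hd (inverse f y)) = df (inverse f y))
  by apply derive_pt_eq_0, is_derive_Reals, f_derive.
replace (/ df (inverse f y)) with (1 / derive_pt f (inverse f y) (Hd (inverse f y)))
  by (rewrite Hv; field; apply Rgt_not_eq, df_pos).
assert (Hc : continuity_pt (inverse f) y)
  by apply continuity_pt_filterlim, inverse_continuous.
apply is_derive_Reals, (Ranalysis5.derivable_pt_lim_recip_interv f (inverse f)
  (y - 1) (y + 1) y (fun a _ => Hd a) Hc ltac:(lra) ltac:(lra) Hi).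
- intros; apply inverse_right.
- rewrite Hv; apply Rgt_not_eq, df_pos.
Qed.

End Inverse_function.

Definition primitive (f : R -> R) (x : R) : R := RInt f 0 x.

Lemma primitive_derive (f : R -> R) :
  (forall x, continuous f x) -> forall x, is_derive (primitive f) x (f x).
Proof.
intros Hf x; unfold primitive; apply (is_derive_RInt f _ 0); [| apply Hf].
apply filter_forall; intros y; apply (@RInt_correct R_CompleteNormedModule).
apply (@ex_RInt_continuous R_CompleteNormedModule); intros; apply Hf.
Qed.

Lemma primitive_0 (f : R -> R) : primitive f 0 = 0.
Proof. apply (@RInt_point R_CompleteNormedModule). Qed.

Lemma is_derive_continuous (f : R -> R) (x l : R) :
  is_derive f x l -> continuous f x.
Proof.
intros H; apply (@ex_derive_continuous R_AbsRing R_NormedModule); now exists l.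
Qed.

(** Gives smoothness without computing a higher derivative: by induction every iterated derivative
    agrees with some member of the class, which is differentiable. It is applied to polynomials in
    functions that solve a polynomial system. *)
Lemma smooth_of_derivation_class (P : (R -> R) -> Prop) :
  (forall f, P f -> exists g, P g /\ forall x, is_derive f x (g x)) ->
  forall f, P f -> forall n x, ex_derive_n f n x.
Proof.
intros HP f Hf n; revert f Hf; destruct n as [| n]; [intros; exact I |].
intros f Hf.
enough (H : exists g, P g /\ forall x, Derive_n f n x = g x).
  destruct H as [g [Hg He]]; intros x; simpl.
  apply (ex_derive_ext g); [intros; symmetry; apply He |].
  destruct (HP g Hg) as [g' [_ H']]; exists (g' x); apply H'.
induction n as [| n [g [Hg He]]]; [now exists f |].
destruct (HP g Hg) as [g' [Hg' Hd]]; exists g'; split; [exact Hg' |].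
intros x; simpl; rewrite (Derive_ext _ g) by apply He.
apply is_derive_unique, Hd.
Qed.

Lemma unit_circle_angle (a b : R) :
  a ^ 2 + b ^ 2 = 1 -> exists t, cos t = a /\ sin t = b.
Proof.
intros H.
assert (Ha : -1 <= a <= 1) by nra.
assert (Hs : sqrt (1 - a ^ 2) = Rabs b)
  by (rewrite <- sqrt_Rsqr_abs; f_equal; unfold Rsqr; lra).
pose proof (cos_acos a Ha); pose proof (sin_acos a Ha) as Hsin.
replace (1 - Rsqr a) with (1 - a ^ 2) in Hsin by (unfold Rsqr; ring).
rewrite Hs in Hsin.
destruct (Rle_or_lt 0 b) as [h | h].
- exists (acos a); split; [easy |]; rewrite Hsin; now apply Rabs_pos_eq.
- exists (- acos a); rewrite cos_neg, sin_neg; split; [easy |].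
  rewrite Hsin, Rabs_left; lra.
Qed.

(** * The potential well of the logarithm of the curvature *)

(** The Taylor coefficients of (exp x - 1 - x) / x ^ 2. The series, unlike the quotient, is defined
    and smooth across x = 0. *)
Definition exp_rem2_coef : nat -> R :=
  PS_decr_1 (PS_decr_1 (fun n => / INR (fact n))).

Definition exp_rem2 : R -> R := PSeries exp_rem2_coef.

Lemma exp_coef_radius : CV_radius (fun n => / INR (fact n)) = p_infty.
Proof.
apply CV_radius_infinite_DAlembert.
- intros n; apply Rinv_neq_0_compat, INR_fact_neq_0.
- apply (is_lim_seq_ext (fun n => / INR (S n))).
  + intros n; rewrite Rabs_pos_eq.
    * rewrite fact_simpl, mult_INR; field; split;
        [apply INR_fact_neq_0 | now apply not_0_INR].
    * apply Rmult_le_pos; [left; apply Rinv_0_lt_compat, INR_fact_lt_0 |].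
      rewrite Rinv_inv; apply pos_INR.
  + apply (is_lim_seq_incr_1 (fun n => / INR n)).
    apply (is_lim_seq_inv INR p_infty); [apply is_lim_seq_INR | easy].
Qed.

Lemma exp_rem2_radius (x : R) : Rbar_lt (Rabs x) (CV_radius exp_rem2_coef).
Proof.
unfold exp_rem2_coef; rewrite !CV_radius_decr_1, exp_coef_radius; exact I.
Qed.

Lemma exp_rem2_spec (x : R) : exp x = 1 + x + x ^ 2 * exp_rem2 x.
Proof.
assert (H : ex_pseries (fun n => / INR (fact n)) x)
  by (exists (exp x); apply is_exp_Reals).
assert (H' : ex_pseries (PS_decr_1 (fun n => / INR (fact n))) x).
  apply CV_radius_inside; rewrite CV_radius_decr_1, exp_coef_radius; exact I.
rewrite <- (is_pseries_unique _ _ _ (is_exp_Reals x)), PSeries_decr_1 by exact H.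
rewrite PSeries_decr_1 by exact H'.
unfold exp_rem2, exp_rem2_coef, PS_decr_1; simpl; field.
Qed.

Lemma exp_rem2_0 : exp_rem2 0 = 1 / 2.
Proof.
unfold exp_rem2; rewrite PSeries_0; unfold exp_rem2_coef, PS_decr_1; simpl; field.
Qed.

Lemma exp_rem2_pos (x : R) : 0 < exp_rem2 x.
Proof.
destruct (Req_dec x 0) as [-> | h]; [rewrite exp_rem2_0; lra |].
pose proof (exp_ineq1 x h); pose proof (exp_rem2_spec x).
assert (0 < x ^ 2) by nra; nra.
Qed.

Lemma exp_rem2_derive (x : R) :
  is_derive exp_rem2 x (PSeries (PS_derive exp_rem2_coef) x).
Proof. apply is_derive_PSeries, exp_rem2_radius. Qed.

(* A signed square root of [exp (2 z) - 1 - 2 z]: it vanishes to first order at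
   the bottom [z = 0] of the well, hence is a diffeomorphism of the line. *)
Definition amp (z : R) : R := 2 * z * sqrt (exp_rem2 (2 * z)).

Definition damp (z : R) : R :=
  2 * sqrt (exp_rem2 (2 * z)) +
  2 * z * (PSeries (PS_derive exp_rem2_coef) (2 * z) / sqrt (exp_rem2 (2 * z))).

Lemma amp_sq (z : R) : amp z ^ 2 = exp (2 * z) - 1 - 2 * z.
Proof.
unfold amp; rewrite Rpow_mult_distr, pow2_sqrt by (left; apply exp_rem2_pos).
rewrite (exp_rem2_spec (2 * z)); ring.
Qed.

Lemma amp_derive (z : R) : is_derive amp z (damp z).
Proof.
pose proof (exp_rem2_pos (2 * z)) as Hp.
pose proof (sqrt_lt_R0 _ Hp).
unfold amp, damp; auto_derive.
- repeat split; [eexists; apply exp_rem2_derive | exact Hp].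
- rewrite_Derive (exp_rem2_derive (2 * z)); field; lra.
Qed.

Lemma damp_continuous (z : R) : continuous damp z.
Proof.
assert (Hd : is_derive (PSeries (PS_derive exp_rem2_coef)) (2 * z)
  (PSeries (PS_derive (PS_derive exp_rem2_coef)) (2 * z))).
  apply is_derive_PSeries; rewrite CV_radius_derive; apply exp_rem2_radius.
pose proof (exp_rem2_pos (2 * z)) as Hp.
pose proof (sqrt_lt_R0 _ Hp).
apply (@ex_derive_continuous R_AbsRing R_NormedModule); unfold damp; auto_derive.
assert (He : ex_derive exp_rem2 (2 * z)) by (eexists; apply exp_rem2_derive).
assert (Hf : ex_derive (PSeries (PS_derive exp_rem2_coef)) (2 * z))
  by (eexists; apply Hd).
repeat split; [exact He | exact Hp | exact Hf | exact He | exact Hp |].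
apply Rgt_not_eq; assumption.
Qed.

(** Half the derivative of [amp_sq]: the right-hand side is the force of the well up to sign. *)
Lemma amp_damp (z : R) : amp z * damp z = exp (2 * z) - 1.
Proof.
assert (H : is_derive (fun z => amp z ^ 2) z (2 * (amp z * damp z))).
  auto_derive; [now exists (damp z); apply amp_derive |].
  rewrite_Derive (amp_derive z); ring.
assert (H' : is_derive (fun z => amp z ^ 2) z (2 * (exp (2 * z) - 1))).
  apply (is_derive_ext (fun z => exp (2 * z) - 1 - 2 * z));
    [intros; symmetry; apply amp_sq | auto_derive; [easy | ring]].
apply is_derive_unique in H; apply is_derive_unique in H'; lra.
Qed.

Lemma amp_pos (z : R) : 0 < z -> 0 < amp z.
Proof.
intros; unfold amp; pose proof (sqrt_lt_R0 _ (exp_rem2_pos (2 * z))); nra.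
Qed.

Lemma amp_neg (z : R) : z < 0 -> amp z < 0.
Proof.
intros; unfold amp; pose proof (sqrt_lt_R0 _ (exp_rem2_pos (2 * z))); nra.
Qed.

Lemma amp_0 : amp 0 = 0.
Proof. unfold amp; ring. Qed.

Lemma damp_0 : damp 0 = sqrt 2.
Proof.
unfold damp; rewrite !Rmult_0_r, exp_rem2_0, Rmult_0_l, Rplus_0_r.
rewrite <- (sqrt_pow2 2) at 1 by lra; rewrite <- sqrt_mult by lra.
f_equal; field.
Qed.

(** Away from 0, [amp z] and exp (2 z) - 1 have the same sign, so [amp_damp] decides. At 0 that
    identity is void and the value sqrt 2 is used. *)
Lemma damp_pos (z : R) : 0 < damp z.
Proof.
pose proof (amp_damp z) as H.
destruct (Rtotal_order z 0) as [h | [-> | h]].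
- pose proof (amp_neg z h); pose proof (exp_increasing (2 * z) 0).
  rewrite exp_0 in *; nra.
- rewrite damp_0; apply sqrt_lt_R0; lra.
- pose proof (amp_pos z h); pose proof (exp_increasing 0 (2 * z)).
  rewrite exp_0 in *; nra.
Qed.

Lemma amp_onto (y : R) : exists z, amp z = y.
Proof.
assert (Hc : continuity amp).
  intros x; apply derivable_continuous_pt; exists (damp x).
  apply is_derive_Reals, amp_derive.
destruct (Rle_or_lt 0 y) as [h | h].
- assert (y <= amp y).
    destruct h as [h | <-]; [| rewrite amp_0; lra].
    assert (y ^ 2 <= amp y ^ 2).
      rewrite amp_sq; replace (2 * y) with (y + y) by ring; rewrite exp_plus.
      pose proof (exp_ineq1 y); nra.
    pose proof (amp_pos y h); nra.
  destruct (IVT_gen amp 0 y y Hc) as [z [_ Hz]]; [| now exists z].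
  rewrite amp_0, Rmin_left, Rmax_right; lra.
(* Chosen so that - 1 - 2 z = y ^ 2; then [amp_sq] gives amp z ^ 2 > y ^ 2. *)
- set (z := - (1 + y ^ 2) / 2).
  assert (Hz : z < 0) by (unfold z; nra).
  assert (amp z <= y).
    assert (y ^ 2 <= amp z ^ 2).
      rewrite amp_sq; pose proof (exp_pos (2 * z)); unfold z in *; nra.
    pose proof (amp_neg z Hz); nra.
  destruct (IVT_gen amp 0 z y Hc) as [t [_ Ht]]; [| now exists t].
  rewrite amp_0, Rmin_right, Rmax_left; lra.
Qed.

Definition zeta : R -> R := inverse amp.

Definition dzeta (y : R) : R := / damp (zeta y).

Lemma amp_zeta (y : R) : amp (zeta y) = y.
Proof. apply inverse_right, amp_onto. Qed.

Lemma zeta_amp (z : R) : zeta (amp z) = z.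
Proof.
apply (inverse_left amp damp); [apply amp_derive | apply damp_pos | apply amp_onto].
Qed.

Lemma zeta_increasing (x y : R) : x < y -> zeta x < zeta y.
Proof.
apply (inverse_increasing amp damp);
  [apply amp_derive | apply damp_pos | apply amp_onto].
Qed.

Lemma zeta_nondecreasing (x y : R) : x <= y -> zeta x <= zeta y.
Proof. intros [h | ->]; [left; now apply zeta_increasing | lra]. Qed.

Lemma zeta_derive (y : R) : is_derive zeta y (dzeta y).
Proof.
apply (inverse_derive amp damp); [apply amp_derive | apply damp_pos | apply amp_onto].
Qed.

Lemma dzeta_pos (y : R) : 0 < dzeta y.
Proof. apply Rinv_0_lt_compat, damp_pos. Qed.

Lemma dzeta_continuous (y : R) : continuous dzeta y.
Proof.
apply continuous_comp with (f := fun y => damp (zeta y)) (g := Rinv).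
- apply continuous_comp; [eapply is_derive_continuous, zeta_derive |].
  apply damp_continuous.
- apply continuous_Rinv, Rgt_not_eq, damp_pos.
Qed.

Lemma zeta_0 : zeta 0 = 0.
Proof. rewrite <- amp_0 at 1; apply zeta_amp. Qed.

Lemma dzeta_0 : dzeta 0 = / sqrt 2.
Proof. unfold dzeta; now rewrite zeta_0, damp_0. Qed.

Lemma zeta_energy (y : R) : y ^ 2 = exp (2 * zeta y) - 1 - 2 * zeta y.
Proof. rewrite <- amp_sq; now rewrite amp_zeta. Qed.

(** The derivative of [zeta_energy] in y, halved. This is the identity by which sigma = A cos p
    satisfies sigma' = 1 - h ^ 2. *)
Lemma zeta_force (y : R) : (exp (2 * zeta y) - 1) * dzeta y = y.
Proof.
rewrite <- amp_damp, amp_zeta; unfold dzeta; field.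
apply Rgt_not_eq, damp_pos.
Qed.

Lemma zeta_neg (y : R) : y < 0 -> zeta y < 0.
Proof. intros h; rewrite <- zeta_0; now apply zeta_increasing. Qed.

(** * The solution of energy [A ^ 2 / 2], parametrized by its phase *)

Lemma primitive_period (f : R -> R) (T : R) :
  (forall x, continuous f x) -> (forall x, f (x + T) = f x) ->
  forall x, primitive f (x + T) = primitive f x + primitive f T.
Proof.
intros Hc HT x.
enough (primitive f (x + T) - primitive f x = primitive f (0 + T) - primitive f 0)
  by (rewrite primitive_0, Rplus_0_l in *; lra).
apply (derive_0_const (fun x => primitive f (x + T) - primitive f x)).
clear x; intros x.
pose proof (primitive_derive f Hc) as Hp.
auto_derive; [split; [| split]; try easy; eexists; apply Hp |].
rewrite_Derive (Hp (x + T)); rewrite_Derive (Hp x); rewrite HT; ring.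
Qed.

Lemma primitive_reflect (f : R -> R) (c : R) :
  (forall x, continuous f x) -> (forall x, f (c - x) = f x) ->
  forall x y, primitive f (c - x) + primitive f x = primitive f (c - y) + primitive f y.
Proof.
intros Hc Hs.
apply (derive_0_const (fun x => primitive f (c - x) + primitive f x)).
intros x; pose proof (primitive_derive f Hc) as Hp.
auto_derive; [split; [| split]; try easy; eexists; apply Hp |].
rewrite_Derive (Hp (c - x)); rewrite_Derive (Hp x); rewrite Hs; ring.
Qed.

(** As functions of y = A sin p, [dzeta] is dt/dp and [turn] is dtheta/dp = h dt/dp. *)
Definition turn (y : R) : R := exp (zeta y) * dzeta y.

Lemma turn_pos (y : R) : 0 < turn y.
Proof. apply Rmult_lt_0_compat; [apply exp_pos | apply dzeta_pos]. Qed.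

Lemma turn_continuous (y : R) : continuous turn y.
Proof.
apply (@continuous_mult R_UniformSpace R_AbsRing); [| apply dzeta_continuous].
apply continuous_comp; [eapply is_derive_continuous, zeta_derive | apply continuous_exp].
Qed.

Definition arc (A : R) : R -> R := primitive (fun p => dzeta (A * sin p)).

Definition angle (A : R) : R -> R := primitive (fun p => turn (A * sin p)).

Definition arc_period (A : R) : R := arc A (2 * PI).

Definition turning (A : R) : R := angle A (2 * PI).

Lemma comp_A_sin_continuous (f : R -> R) (A p : R) :
  (forall y, continuous f y) -> continuous (fun p => f (A * sin p)) p.
Proof.
intros Hf; apply (continuous_comp (fun p => A * sin p)); [| apply Hf].
apply (is_derive_continuous _ _ (A * cos p)); auto_derive; [easy | ring].
Qed.

Lemma A_sin_period (f : R -> R) (A p : R) : f (A * sin (p + 2 * PI)) = f (A * sin p).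
Proof. now rewrite sin_plus, cos_2PI, sin_2PI, Rmult_0_r, Rplus_0_r, Rmult_1_r. Qed.

Lemma arc_derive (A p : R) : is_derive (arc A) p (dzeta (A * sin p)).
Proof.
apply (primitive_derive (fun p => dzeta (A * sin p))).
intros; apply comp_A_sin_continuous, dzeta_continuous.
Qed.

Lemma angle_derive (A p : R) : is_derive (angle A) p (turn (A * sin p)).
Proof.
apply (primitive_derive (fun p => turn (A * sin p))).
intros; apply comp_A_sin_continuous, turn_continuous.
Qed.

Lemma arc_period_spec (A p : R) : arc A (p + 2 * PI) = arc A p + arc_period A.
Proof.
apply primitive_period; [| intros; now rewrite (A_sin_period dzeta)].
intros; apply comp_A_sin_continuous, dzeta_continuous.
Qed.

Lemma angle_period_spec (A p : R) : angle A (p + 2 * PI) = angle A p + turning A.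
Proof.
apply primitive_period; [| intros; now rewrite (A_sin_period turn)].
intros; apply comp_A_sin_continuous, turn_continuous.
Qed.

(** The reflection p -> PI - p fixes sin p, so the curve turns equally on the way in and on the way
    out. The remaining half lies between two consecutive zeros of cos p, as the comparison argument
    requires. *)
Lemma turning_half (A : R) :
  turning A = 2 * (angle A (PI / 2) - angle A (- (PI / 2))).
Proof.
assert (H : angle A (PI - - (PI / 2)) + angle A (- (PI / 2)) =
            angle A (PI - PI / 2) + angle A (PI / 2)).
  apply primitive_reflect.
  - intros; apply comp_A_sin_continuous, turn_continuous.
  - intros x; now rewrite sin_PI_x.
replace (PI - PI / 2) with (PI / 2) in H by field.
pose proof (angle_period_spec A (- (PI / 2))) as H'.
replace (- (PI / 2) + 2 * PI) with (PI - - (PI / 2)) in H' by field.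
lra.
Qed.

Lemma A_sin_bound (A p : R) : 0 <= A -> - A <= A * sin p <= A.
Proof. intros h; pose proof (SIN_bound p); nra. Qed.

(** [dzeta] has a positive minimum k on [- A, A], so [arc A] grows with slope at least k and has
    passed t by the phase t / k. *)
Lemma arc_onto (A : R) : 0 <= A -> forall t, exists p, arc A p = t.
Proof.
intros hA.
destruct (continuity_ab_min dzeta (- A) A) as [m [Hm _]]; [lra | |].
  intros; apply continuity_pt_filterlim, dzeta_continuous.
pose proof (dzeta_pos m) as Hp; set (k := dzeta m) in *.
assert (Hs : forall p, k <= dzeta (A * sin p)) by (intros; apply Hm; now apply A_sin_bound).
assert (Hc : continuity (arc A)).
  intros x; apply continuity_pt_filterlim; eapply is_derive_continuous, arc_derive.
assert (H0 : arc A 0 = 0) by apply primitive_0.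
intros t.
pose proof (fun a b h => derive_ge_slope (arc A) _ a b k h
  (fun x _ => arc_derive A x) (fun x _ => Hs x)) as Hk.
destruct (Rle_or_lt 0 t) as [h | h].
- assert (h' : 0 <= t / k) by (apply Rdiv_le_0_compat; lra).
  specialize (Hk 0 (t / k) h'); rewrite H0 in Hk.
  replace (k * (t / k - 0)) with t in Hk by (field; lra).
  destruct (IVT_gen (arc A) 0 (t / k) t Hc) as [p [_ Hpt]]; [| now exists p].
  rewrite H0, Rmin_left, Rmax_right; lra.
- assert (h' : t / k <= 0).
    apply Rmult_le_reg_r with k; [lra |]; unfold Rdiv; rewrite Rmult_assoc, Rinv_l; lra.
  specialize (Hk (t / k) 0 h'); rewrite H0 in Hk.
  replace (k * (0 - t / k)) with (- t) in Hk by (field; lra).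
  destruct (IVT_gen (arc A) 0 (t / k) t Hc) as [p [_ Hpt]]; [| now exists p].
  rewrite H0, Rmin_right, Rmax_left; lra.
Qed.

Lemma arc_increasing (A p q : R) : p < q -> arc A p < arc A q.
Proof.
apply (derive_pos_increasing _ (fun p => dzeta (A * sin p)));
  intros; [apply arc_derive | apply dzeta_pos].
Qed.

Lemma angle_increasing (A p q : R) : p < q -> angle A p < angle A q.
Proof.
apply (derive_pos_increasing _ (fun p => turn (A * sin p)));
  intros; [apply angle_derive | apply turn_pos].
Qed.

Lemma arc_period_pos (A : R) : 0 < arc_period A.
Proof.
unfold arc_period; replace 0 with (arc A 0) by apply primitive_0.
apply arc_increasing; pose proof PI_RGT_0; lra.
Qed.

Definition phase (A : R) : R -> R := inverse (arc A).

(** For A = 0 these formulas give the rest point h = 1, sigma = 0, which is the circle. *)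
Definition sol_h (A t : R) : R := exp (zeta (A * sin (phase A t))).

Definition sol_sigma (A t : R) : R := A * cos (phase A t).

Definition sol_theta (A t : R) : R := angle A (phase A t).

Section Solution.

Context (A : R) (hA : 0 <= A).

Lemma arc_phase (t : R) : arc A (phase A t) = t.
Proof. apply inverse_right, arc_onto, hA. Qed.

Lemma phase_arc (p : R) : phase A (arc A p) = p.
Proof.
apply (inverse_left (arc A) (fun p => dzeta (A * sin p)));
  [apply arc_derive | intros; apply dzeta_pos | apply arc_onto, hA].
Qed.

Lemma phase_increasing (s t : R) : s < t -> phase A s < phase A t.
Proof.
apply (inverse_increasing (arc A) (fun p => dzeta (A * sin p)));
  [apply arc_derive | intros; apply dzeta_pos | apply arc_onto, hA].
Qed.

Lemma phase_derive (t : R) :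
  is_derive (phase A) t (/ dzeta (A * sin (phase A t))).
Proof.
apply (inverse_derive (arc A) (fun p => dzeta (A * sin p)));
  [apply arc_derive | intros; apply dzeta_pos | apply arc_onto, hA].
Qed.

Lemma phase_period (t : R) : phase A (t + arc_period A) = phase A t + 2 * PI.
Proof. rewrite <- (phase_arc (phase A t + 2 * PI)); now rewrite arc_period_spec, arc_phase. Qed.

Lemma sol_h_pos (t : R) : 0 < sol_h A t.
Proof. apply exp_pos. Qed.

Lemma sol_h_derive (t : R) : is_derive (sol_h A) t (sol_h A t * sol_sigma A t).
Proof.
pose proof (phase_derive t) as Hp.
pose proof (zeta_derive (A * sin (phase A t))) as Hz.
pose proof (dzeta_pos (A * sin (phase A t))).
unfold sol_h, sol_sigma; auto_derive.
- repeat split; eexists; [apply Hz | apply Hp].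
- rewrite_Derive Hz; rewrite_Derive Hp; field; lra.
Qed.

Lemma sol_sigma_derive (t : R) : is_derive (sol_sigma A) t (1 - sol_h A t ^ 2).
Proof.
pose proof (phase_derive t) as Hp.
pose proof (dzeta_pos (A * sin (phase A t))).
unfold sol_h, sol_sigma; auto_derive.
- repeat split; eexists; apply Hp.
- rewrite_Derive Hp.
  pose proof (zeta_force (A * sin (phase A t))) as Hf.
  replace (2 * zeta (A * sin (phase A t)))
    with (zeta (A * sin (phase A t)) + zeta (A * sin (phase A t))) in Hf by ring.
  rewrite exp_plus in Hf.
  set (E := exp _) in *; set (d := dzeta _) in *; clearbody E d.
  transitivity (- (A * sin (phase A t)) / d); [field; lra | rewrite <- Hf; field; lra].
Qed.

Lemma sol_theta_derive (t : R) : is_derive (sol_theta A) t (sol_h A t).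
Proof.
pose proof (phase_derive t) as Hp.
pose proof (dzeta_pos (A * sin (phase A t))).
pose proof (angle_derive A (phase A t)) as Ha.
unfold sol_theta, sol_h; auto_derive.
- repeat split; eexists; [apply Ha | apply Hp].
- rewrite_Derive Ha; rewrite_Derive Hp; unfold turn; field; lra.
Qed.

Lemma sol_energy (t : R) :
  sol_sigma A t ^ 2 + sol_h A t ^ 2 - 2 * ln (sol_h A t) = A ^ 2 + 1.
Proof.
unfold sol_sigma, sol_h; rewrite ln_exp.
pose proof (zeta_energy (A * sin (phase A t))) as He.
replace (2 * zeta (A * sin (phase A t)))
  with (zeta (A * sin (phase A t)) + zeta (A * sin (phase A t))) in He at 1 by ring.
rewrite exp_plus in He.
pose proof (sin2_cos2 (phase A t)) as Ht; unfold Rsqr in Ht; nra.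
Qed.

Lemma sol_theta_period (t : R) :
  sol_theta A (t + arc_period A) = sol_theta A t + turning A.
Proof. unfold sol_theta; now rewrite phase_period, angle_period_spec. Qed.

End Solution.

(** * Sturm comparison: bounds for the turning of one excursion *)

(* [v] solves [v'' + q v = 0] in the variable [theta] and has consecutive zeros
   [a] and [b]; the Wronskian of [v] with the sine of frequency [w] having the
   same two zeros vanishes at both, so its derivative changes sign. *)
Lemma sturm_comparison (a b w : R) (v v1 q theta m : R -> R) :
  a < b -> 0 < w ->
  (forall p, is_derive theta p (m p)) -> (forall p, 0 < m p) ->
  (forall p, is_derive v p (v1 p * m p)) ->
  (forall p, is_derive v1 p (- q p * v p * m p)) ->
  v a = 0 -> v b = 0 -> (forall p, a < p < b -> 0 < v p) ->
  w * (theta b - theta a) = PI ->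
  ~ (forall p, a < p < b -> q p < w ^ 2) /\ ~ (forall p, a < p < b -> w ^ 2 < q p).
Proof.
intros Hab Hw Hth Hm Hv Hv1 Hva Hvb Hpos HPI.
set (W := fun p => v1 p * sin (w * (theta p - theta a)) -
                   v p * (w * cos (w * (theta p - theta a)))).
set (dW := fun p => (w ^ 2 - q p) * v p * sin (w * (theta p - theta a)) * m p).
assert (HW : forall p, is_derive W p (dW p)).
  intros p; unfold W, dW; auto_derive.
  - repeat split; eexists; [apply Hv1 | apply Hth | apply Hv | apply Hth].
  - rewrite_Derive (Hv1 p); rewrite_Derive (Hth p); rewrite_Derive (Hv p);
    unfold Rminus; ring.
assert (Wa : W a = 0).
  unfold W; rewrite Hva, Rminus_diag, Rmult_0_r, sin_0; ring.
assert (Wb : W b = 0) by (unfold W; rewrite Hvb, HPI, sin_PI; ring).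
(* As theta increases, the argument of the sine runs exactly through (0, PI). *)
assert (Hs : forall p, a < p < b -> 0 < sin (w * (theta p - theta a))).
  intros p Hp.
  pose proof (derive_pos_increasing theta m Hth Hm a p (proj1 Hp)).
  pose proof (derive_pos_increasing theta m Hth Hm p b (proj2 Hp)).
  apply sin_gt_0; [apply Rmult_lt_0_compat; lra |].
  rewrite <- HPI; apply Rmult_lt_compat_l; lra.
assert (Hvs : forall p, a < p < b -> 0 < v p * sin (w * (theta p - theta a)) * m p).
  intros p Hp; repeat apply Rmult_lt_0_compat; [now apply Hpos | now apply Hs | apply Hm].
split; intros Hq.
- enough (W a < W b) by lra.
  apply (derive_pos_lt W dW); [exact Hab | intros; apply HW |].
  intros p Hp; unfold dW; specialize (Hq p Hp); specialize (Hvs p Hp).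
  replace (_ * m p) with
    ((w ^ 2 - q p) * (v p * sin (w * (theta p - theta a)) * m p)) by ring.
  apply Rmult_lt_0_compat; lra.
- enough (- W a < - W b) by lra.
  apply (derive_pos_lt (fun p => - W p) (fun p => - dW p)); [exact Hab | |].
    intros p _; auto_derive; [eexists; apply HW |]; rewrite_Derive (HW p); ring.
  intros p Hp; unfold dW; specialize (Hq p Hp); specialize (Hvs p Hp).
  replace (- _) with
    ((q p - w ^ 2) * (v p * sin (w * (theta p - theta a)) * m p)) by ring.
  apply Rmult_lt_0_compat; lra.
Qed.

Section Turning_bounds.

Context (A : R) (hA : 0 < A).

Let z (p : R) : R := zeta (A * sin p).
Let s (p : R) : R := A * cos p.
Let m (p : R) : R := turn (A * sin p).
Let Delta : R := angle A (PI / 2) - angle A (- (PI / 2)).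

Let half_pi_pos : - (PI / 2) < PI / 2.
Proof. pose proof PI_RGT_0; lra. Qed.

Let Delta_pos : 0 < Delta.
Proof. unfold Delta; pose proof (angle_increasing A _ _ half_pi_pos); lra. Qed.

(** With dtheta = m dp, this lemma and the next read dz/dtheta = sigma / h and dsigma/dtheta = 1 / h
    - h. *)
Let z_derive (p : R) : is_derive z p (exp (- z p) * s p * m p).
Proof.
pose proof (zeta_derive (A * sin p)) as Hz.
unfold z, s, m, turn; auto_derive; [now eexists; apply Hz |].
rewrite_Derive Hz; rewrite exp_Ropp; field; apply Rgt_not_eq, exp_pos.
Qed.

Let s_derive (p : R) :
  is_derive s p ((exp (- z p) - exp (z p)) * m p).
Proof.
unfold s; auto_derive; [easy |]; unfold z, m, turn.
pose proof (zeta_force (A * sin p)) as Hf.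
replace (2 * zeta (A * sin p)) with (zeta (A * sin p) + zeta (A * sin p)) in Hf by ring.
rewrite exp_plus in Hf; rewrite exp_Ropp.
set (E := exp _) in *; assert (0 < E) by apply exp_pos.
set (d := dzeta _) in *; clearbody E d.
transitivity (- (A * sin p)); [ring | rewrite <- Hf; field; lra].
Qed.

(* The weight [exp (c z)], that is [h ^ c], makes [v] the [theta]-derivative of
   a power of [h]: [c = 1] makes [q < 4] and [c = 1 / 3] makes [q >= 2]. *)
Let weighted_v (c p : R) : R := exp (c * z p) * s p.

Let weighted_v1 (c p : R) : R :=
  exp (c * z p) * (c * exp (- z p) * s p ^ 2 + exp (- z p) - exp (z p)).

(** For c = 1 the sigma term drops out and q = 4 - 2 / h ^ 2; for c = 1 / 3 the constant in the
    bracket drops out and q = 2 + (2 / 9) sigma ^ 2 / h ^ 2. *)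
Let weighted_q (c p : R) : R :=
  1 + 3 * c + exp (- z p) ^ 2 * (1 - 3 * c + c * (1 - c) * s p ^ 2).

Let weighted_v_derive (c p : R) :
  is_derive (weighted_v c) p (weighted_v1 c p * m p).
Proof.
pose proof (z_derive p) as Hz; pose proof (s_derive p) as Hs.
unfold weighted_v, weighted_v1.
clearbody z s m.
auto_derive; [repeat split; eexists; [apply Hz | apply Hs] |].
rewrite_Derive Hz; rewrite_Derive Hs; ring.
Qed.

Let weighted_v1_derive (c p : R) :
  is_derive (weighted_v1 c) p (- weighted_q c p * weighted_v c p * m p).
Proof.
pose proof (z_derive p) as Hz; pose proof (s_derive p) as Hs.
unfold weighted_v, weighted_v1, weighted_q.
clearbody z s m.
auto_derive; [repeat split; eexists; [apply Hz | apply Hz | apply Hs | apply Hz | apply Hz] |].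
rewrite_Derive Hz; rewrite_Derive Hs.
rewrite !exp_Ropp; set (E := exp (z p)); assert (0 < E) by apply exp_pos.
field; lra.
Qed.

Let weighted_comparison (c w : R) :
  0 < w -> w * Delta = PI ->
  ~ (forall p, - (PI / 2) < p < PI / 2 -> weighted_q c p < w ^ 2) /\
  ~ (forall p, - (PI / 2) < p < PI / 2 -> w ^ 2 < weighted_q c p).
Proof.
intros Hw HD.
apply (sturm_comparison _ _ w (weighted_v c) (weighted_v1 c) _ (angle A) m);
  try assumption.
- intros; apply angle_derive.
- intros; apply turn_pos.
- intros; apply weighted_v_derive.
- intros; apply weighted_v1_derive.
- unfold weighted_v, s; rewrite cos_neg, cos_PI2; ring.
- unfold weighted_v, s; rewrite cos_PI2; ring.
- intros p Hp; apply Rmult_lt_0_compat; [apply exp_pos |].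
  apply Rmult_lt_0_compat; [exact hA | now apply cos_gt_0].
Qed.

(** Were Theta at most pi, the comparison frequency PI / Delta would be at least 2, and its square
    would exceed q everywhere. *)
Lemma turning_gt_PI : PI < turning A.
Proof.
rewrite turning_half; fold Delta.
destruct (Rlt_or_le PI (2 * Delta)) as [h | h]; [exact h | exfalso].
pose proof PI_RGT_0.
assert (Hw : 2 <= PI / Delta)
  by (apply Rmult_le_reg_r with Delta; [| field_simplify]; lra).
destruct (weighted_comparison 1 (PI / Delta)) as [Hc _]; [lra | field; lra |].
apply Hc; intros p _; unfold weighted_q.
pose proof (exp_pos (- z p)); nra.
Qed.

(** Were Theta at least sqrt 2 pi, the square of the comparison frequency would be at most 2, below
    q between the zeros. *)
Lemma turning_lt_sqrt2_PI : turning A < sqrt 2 * PI.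
Proof.
rewrite turning_half; fold Delta.
destruct (Rlt_or_le (2 * Delta) (sqrt 2 * PI)) as [h | h]; [exact h | exfalso].
pose proof PI_RGT_0.
assert (Hs : sqrt 2 ^ 2 = 2) by (apply pow2_sqrt; lra).
pose proof (sqrt_lt_R0 2 ltac:(lra)).
assert (Hw : PI / Delta <= sqrt 2).
  apply Rmult_le_reg_r with Delta; [lra | field_simplify; [| lra]]; nra.
assert (0 < PI / Delta) by (apply Rdiv_lt_0_compat; lra).
destruct (weighted_comparison (1 / 3) (PI / Delta)) as [_ Hc]; [lra | field; lra |].
apply Hc; intros p Hp; unfold weighted_q.
(* sigma is nonzero between the extrema, which makes q > 2 strict there. *)
assert (0 < s p) by (apply Rmult_lt_0_compat; [lra | now apply cos_gt_0]).
assert (0 < (exp (- z p) * s p) ^ 2)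
  by (apply pow_lt, Rmult_lt_0_compat; [apply exp_pos | lra]).
nra.
Qed.

End Turning_bounds.

(** * The range of the turning *)

Lemma exp_zeta_double (y : R) : exp (2 * zeta y) = exp (zeta y) ^ 2.
Proof. replace (2 * zeta y) with (zeta y + zeta y) by ring; rewrite exp_plus; ring. Qed.

Lemma turn_0 : turn 0 = / sqrt 2.
Proof. unfold turn; rewrite zeta_0, dzeta_0, exp_0; ring. Qed.

Lemma turn_eq (y : R) : (exp (zeta y) ^ 2 - 1) * turn y = exp (zeta y) * y.
Proof.
pose proof (zeta_force y) as H; rewrite exp_zeta_double in H; unfold turn.
transitivity (exp (zeta y) * ((exp (zeta y) ^ 2 - 1) * dzeta y)); [ring | now rewrite H].
Qed.

(** For y <> 0, squaring [turn_eq] and inserting the energy turns the claim into h ^ 2 (1 - 2 z) <=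
    1, that is 1 - 2 z <= exp (- 2 z). At y = 0 both sides of [turn_eq] vanish and the value 1 /
    sqrt 2 is used. *)
Lemma turn_le_1 (y : R) : turn y <= 1.
Proof.
pose proof (turn_pos y) as Ht.
destruct (Req_dec y 0) as [-> | Hy].
  rewrite turn_0, <- Rinv_1; apply Rinv_le_contravar; [lra |].
  rewrite <- sqrt_1; apply sqrt_le_1_alt; lra.
pose proof (turn_eq y) as He; pose proof (zeta_energy y) as Hen.
pose proof (exp_ineq1_le (- (2 * zeta y))) as Hz.
rewrite exp_Ropp, exp_zeta_double in Hz; rewrite exp_zeta_double in Hen.
pose proof (exp_pos (zeta y)) as Hh.
set (h := exp (zeta y)) in *; set (z := zeta y) in *; clearbody h z.
assert (Hz' : h ^ 2 * (1 - 2 * z) <= 1).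
  apply (Rmult_le_compat_l (h ^ 2)) in Hz; [| nra].
  rewrite Rinv_r in Hz by nra; lra.
assert (Hsq : ((h ^ 2 - 1) * turn y) ^ 2 <= (h ^ 2 - 1) ^ 2) by (rewrite He; nra).
assert (Hne : 0 < (h ^ 2 - 1) ^ 2).
  assert (0 < (h * y) ^ 2)
    by (apply pow2_gt_0, Rmult_integral_contrapositive_currified; lra).
  rewrite He in Hsq; lra.
assert (turn y ^ 2 <= 1) by (apply Rmult_le_reg_l with ((h ^ 2 - 1) ^ 2); lra).
nra.
Qed.

(** Multiplied by 1 - h ^ 2 > 0, the claim is h y ^ 2 <= 2 (1 - h ^ 2). The energy and h (1 - z) <=
    1 reduce it to h (h + 3) (h - 1) <= 0, true since h < 1. *)
Lemma turn_neg_le (y : R) : y < 0 -> turn y * - y <= 2.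
Proof.
intros Hy.
pose proof (turn_eq y) as He; pose proof (zeta_energy y) as Hen.
pose proof (exp_ineq1_le (- zeta y)) as Hz.
pose proof (exp_increasing _ _ (zeta_neg y Hy)) as Hh1; rewrite exp_0 in Hh1.
rewrite exp_Ropp in Hz; rewrite exp_zeta_double in Hen.
pose proof (exp_pos (zeta y)) as Hh.
set (h := exp (zeta y)) in *; set (z := zeta y) in *; clearbody h z.
assert (Hz' : h * (1 - z) <= 1).
  apply (Rmult_le_compat_l h) in Hz; [| lra].
  rewrite Rinv_r in Hz by lra; lra.
apply Rmult_le_reg_l with (1 - h ^ 2); [nra |].
replace ((1 - h ^ 2) * (turn y * - y)) with ((h ^ 2 - 1) * turn y * y) by ring.
rewrite He; replace (h * y * y) with (h * y ^ 2) by ring.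
rewrite Hen; nra.
Qed.

(** At A = 0 the integrand is the constant 1 / sqrt 2. This is the limit of the turning for small
    oscillations about the circle. *)
Lemma turning_0 : turning 0 = sqrt 2 * PI.
Proof.
assert (H : forall x y, angle 0 x - x * / sqrt 2 = angle 0 y - y * / sqrt 2).
  apply (derive_0_const (fun x => angle 0 x - x * / sqrt 2)).
  intros x; pose proof (angle_derive 0 x) as Ha.
  auto_derive; [now eexists; apply Ha |].
  rewrite_Derive Ha; rewrite Rmult_0_l, turn_0; ring.
specialize (H (2 * PI) 0); fold (turning 0) in H.
replace (angle 0 0) with 0 in H by (symmetry; apply primitive_0).
pose proof (sqrt_lt_R0 2 ltac:(lra)).
replace (turning 0) with (2 / sqrt 2 * PI) by lra.
rewrite <- (pow2_sqrt 2) at 1 by lra; field; lra.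
Qed.

Lemma turning_continuous : continuity turning.
Proof.
intros A; apply continuity_pt_filterlim, filterlim_locally; intros eps.
pose proof PI_RGT_0 as HPI; pose proof (cond_pos eps) as Heps.
(* Integrated over a length 2 PI, this tolerance gives eps / 2. *)
assert (He : 0 < eps / (4 * PI)) by (apply Rdiv_lt_0_compat; lra).
set (M := Rabs A + 1).
destruct (unifcont_1d turn (- M) M (fun x _ => turn_continuous x) (mkposreal _ He))
  as [d Hd].
assert (Hm : 0 < Rmin d 1) by (apply Rmin_glb_lt; [apply cond_pos | lra]).
exists (mkposreal _ Hm); intros A' HA'.
change (Rabs (A' - A) < Rmin d 1) in HA'.
change (Rabs (turning A' - turning A) < eps).
pose proof (Rmin_l d 1); pose proof (Rmin_r d 1).
assert (Hb : forall p, Rabs (turn (A' * sin p) - turn (A * sin p)) < eps / (4 * PI)).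
  intros p.
  assert (Hs : Rabs (sin p) <= 1) by (apply Rabs_le, SIN_bound).
  pose proof (Rabs_pos (sin p)); pose proof (Rabs_pos A); pose proof (Rabs_pos (A' - A)).
  (* The uniform continuity statement delivers its bound under a double negation. *)
  apply Classical_Prop.NNPP, Hd.
  - apply Rabs_le_between; rewrite Rabs_mult; unfold M; nra.
  - apply Rabs_le_between; rewrite Rabs_mult; unfold M.
    assert (Rabs A' <= Rabs A + 1).
      replace A' with (A + (A' - A)) by ring.
      pose proof (Rabs_triang A (A' - A)); lra.
    nra.
  - change (Rabs (A' * sin p - A * sin p) < d).
    rewrite <- Rmult_minus_distr_r, Rabs_mult; nra.
assert (Hder : forall p, is_derive (fun p => angle A' p - angle A p) p
    (turn (A' * sin p) - turn (A * sin p))).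
  intros p; pose proof (angle_derive A p) as H1; pose proof (angle_derive A' p) as H2.
  auto_derive; [split; [| split]; try easy; eexists; [apply H2 | apply H1] |].
  rewrite_Derive H1; rewrite_Derive H2; ring.
assert (Hb' : forall p, - (eps / (4 * PI)) <= turn (A' * sin p) - turn (A * sin p)
    <= eps / (4 * PI)).
  intros p; apply Rabs_le_between; left; apply Hb.
assert (h2 : 0 <= 2 * PI) by lra.
pose proof (derive_le_slope _ _ 0 (2 * PI) _ h2 (fun p _ => Hder p) (fun p _ => proj2 (Hb' p))) as Hle.
pose proof (derive_ge_slope _ _ 0 (2 * PI) _ h2 (fun p _ => Hder p) (fun p _ => proj1 (Hb' p))) as Hge.
cbv beta in Hle, Hge.
replace (angle A' 0) with 0 in * by (symmetry; apply primitive_0).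
replace (angle A 0) with 0 in * by (symmetry; apply primitive_0).
unfold turning; apply Rabs_lt_between.
replace (eps / (4 * PI) * (2 * PI - 0)) with (eps / 2) in Hle by (field; lra).
replace (- (eps / (4 * PI)) * (2 * PI - 0)) with (- (eps / 2)) in Hge by (field; lra).
lra.
Qed.

(** In half an excursion the phases in [- d, PI / 2] contribute at most PI / 2 + d because [turn] is
    at most 1. On [- PI / 2, - d], [turn_neg_le] bounds the integrand by 2 / (A sin d) = eps / (4
    PI), a contribution below eps / 8. *)
Lemma turning_near_PI (eps : R) :
  0 < eps < PI -> exists A, 0 < A /\ turning A < PI + eps.
Proof.
intros [He HeP]; set (d := eps / 4).
assert (Hs : 0 < sin d) by (apply sin_gt_0; unfold d; lra).
set (A := 8 * PI / (eps * sin d)).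
assert (HA : 0 < A) by (apply Rdiv_lt_0_compat; [lra | now apply Rmult_lt_0_compat]).
exists A; split; [exact HA |].
rewrite turning_half.
pose proof (derive_le_slope (angle A) _ 0 (PI / 2) 1 ltac:(lra)
  (fun p _ => angle_derive A p) (fun p _ => turn_le_1 _)).
pose proof (derive_le_slope (angle A) _ (- d) 0 1 ltac:(unfold d; lra)
  (fun p _ => angle_derive A p) (fun p _ => turn_le_1 _)).
enough (angle A (- d) - angle A (- (PI / 2)) <= eps / (4 * PI) * (- d - - (PI / 2))) as Hl.
  assert (eps / (4 * PI) * (- d - - (PI / 2)) < eps / 8).
    replace (eps / (4 * PI) * (- d - - (PI / 2))) with (eps / 8 - eps / (4 * PI) * d)
      by (field; lra).
    assert (0 < eps / (4 * PI) * d)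
      by (apply Rmult_lt_0_compat; [apply Rdiv_lt_0_compat; lra | unfold d; lra]).
    lra.
  unfold d in *; lra.
apply (derive_le_slope (angle A) (fun p => turn (A * sin p)));
  [unfold d; lra | intros; apply angle_derive |].
intros p Hp.
assert (Hsp : sin p <= - sin d).
  rewrite <- sin_neg; apply sin_incr_1; unfold d in *; lra.
assert (HAs : 8 * PI / eps <= - (A * sin p)).
  replace (8 * PI / eps) with (A * sin d) by (unfold A; field; lra); nra.
assert (HP : 0 < 8 * PI / eps) by (apply Rdiv_lt_0_compat; lra).
pose proof (turn_neg_le (A * sin p) ltac:(lra)).
pose proof (turn_pos (A * sin p)).
apply Rmult_le_reg_r with (8 * PI / eps); [exact HP |].
replace (eps / (4 * PI) * (8 * PI / eps)) with 2 by (field; lra).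
nra.
Qed.

Lemma turning_onto (x : R) :
  PI < x < sqrt 2 * PI -> exists A, 0 < A /\ turning A = x.
Proof.
intros [Hx1 Hx2].
assert (Hs : sqrt 2 < 2).
  rewrite <- (sqrt_pow2 2) at 2 by lra; apply sqrt_lt_1_alt; lra.
pose proof PI_RGT_0.
(* The condition x - PI < PI holds because sqrt 2 < 2. *)
destruct (turning_near_PI (x - PI)) as [A [HA HtA]]; [nra |].
replace (PI + (x - PI)) with x in HtA by ring.
pose proof turning_0 as H0.
destruct (IVT_gen turning 0 A x turning_continuous) as [B [HB HtB]].
  rewrite Rmin_right, Rmax_left; lra.
rewrite Rmin_left, Rmax_right in HB by lra.
exists B; split; [| exact HtB].
(* The intermediate value is not taken at 0, where the turning is sqrt 2 PI > x. *)
destruct HB as [[HB | <-] _]; [exact HB | lra].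
Qed.

(** * Positively curved shrinkers are the explicit solutions *)

Inductive polynomials (G : (R -> R) -> Prop) : (R -> R) -> Prop :=
| polynomials_const c : polynomials G (fun _ => c)
| polynomials_gen f : G f -> polynomials G f
| polynomials_plus f g : polynomials G f -> polynomials G g ->
    polynomials G (fun x => f x + g x)
| polynomials_mult f g : polynomials G f -> polynomials G g ->
    polynomials G (fun x => f x * g x).

(** By the sum and product rules, polynomials are closed under derivation as soon as the generators
    have polynomial derivatives. *)
Lemma polynomials_smooth (G : (R -> R) -> Prop) :
  (forall f, G f -> exists g, polynomials G g /\ forall x, is_derive f x (g x)) ->
  forall f, polynomials G f -> forall n x, ex_derive_n f n x.
Proof.
intros HG; apply smooth_of_derivation_class; intros f Hf.
induction Hf as [c | f Hf | f g Hf [f' [Hf' Df]] Hg [g' [Hg' Dg]]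
                | f g Hf [f' [Hf' Df]] Hg [g' [Hg' Dg]]].
- exists (fun _ => 0); split; [constructor |].
  intros x; apply (@is_derive_const R_AbsRing R_NormedModule).
- now apply HG.
- exists (fun x => f' x + g' x); split; [now apply polynomials_plus |].
  intros x; now apply (@is_derive_plus R_AbsRing R_NormedModule).
- exists (fun x => f' x * g x + f x * g' x); split.
    now apply polynomials_plus; apply polynomials_mult.
  intros x; apply (@is_derive_mult R_AbsRing); try easy; intros; apply Rmult_comm.
Qed.

Lemma inner_eq (z w : C) : inner z w = Re z * Re w + Im z * Im w.
Proof. unfold inner, Re, Im; simpl; ring. Qed.

Lemma Cmod_sq (z : C) : Cmod z ^ 2 = Re z ^ 2 + Im z ^ 2.
Proof. unfold Cmod, Re, Im; apply pow2_sqrt; nra. Qed.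

Lemma Cmod_of_sq (z : C) (a : R) : 0 <= a -> Re z ^ 2 + Im z ^ 2 = a ^ 2 -> Cmod z = a.
Proof.
intros Ha H; unfold Cmod; fold (Re z) (Im z).
rewrite H; now apply sqrt_pow2.
Qed.

Definition pos_shrinker (B : R) (X : R -> C) : Prop :=
  unit_speed X /\
  (forall s, B * inner (X s) (normal X s) = curvature X s) /\
  positively_curved X.

Definition model_angle (r A t0 alpha s : R) : R := sol_theta A (r * s + t0) + alpha.

(** The position in its own moving frame: for B = - r ^ 2 one has <X, N> = k / B = - h / r and <X,
    T> = sigma / r, so X = (sigma T - h N) / r. The differences are written [+ - (1) *] to have
    literally the shape built by the constructors of [polynomials]. *)
Definition model (r A t0 alpha s : R) : C :=
  let h := sol_h A (r * s + t0) in
  let sigma := sol_sigma A (r * s + t0) in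
  let phi := model_angle r A t0 alpha s in
  (/ r * (sigma * cos phi + h * sin phi), / r * (sigma * sin phi + - (1) * (h * cos phi))).

Section Model.

Context (r A t0 alpha : R) (hr : 0 < r) (hA : 0 <= A).

Let h (s : R) : R := sol_h A (r * s + t0).
Let sigma (s : R) : R := sol_sigma A (r * s + t0).
Let phi (s : R) : R := model_angle r A t0 alpha s.

Let h_derive (s : R) : is_derive h s (r * (h s * sigma s)).
Proof.
pose proof (sol_h_derive A hA (r * s + t0)) as H.
unfold h, sigma; auto_derive; [eexists; apply H |]; rewrite_Derive H; ring.
Qed.

Let sigma_derive (s : R) : is_derive sigma s (r * (1 + - (1) * (h s * h s))).
Proof.
pose proof (sol_sigma_derive A hA (r * s + t0)) as H.
unfold h, sigma; auto_derive; [eexists; apply H |]; rewrite_Derive H; ring.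
Qed.

Let phi_derive (s : R) : is_derive phi s (r * h s).
Proof.
pose proof (sol_theta_derive A hA (r * s + t0)) as H.
unfold h, phi, model_angle; auto_derive; [eexists; apply H |]; rewrite_Derive H; ring.
Qed.

Let cos_derive (s : R) :
  is_derive (fun s => cos (phi s)) s (r * (- (1) * (h s * sin (phi s)))).
Proof.
pose proof (phi_derive s) as H; clearbody phi h.
auto_derive; [eexists; apply H |]; rewrite_Derive H; ring.
Qed.

Let sin_derive (s : R) :
  is_derive (fun s => sin (phi s)) s (r * (h s * cos (phi s))).
Proof.
pose proof (phi_derive s) as H; clearbody phi h.
auto_derive; [eexists; apply H |]; rewrite_Derive H; ring.
Qed.

Let model_derive_re (s : R) :
  is_derive (fun s => Re (model r A t0 alpha s)) s (cos (phi s)).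
Proof.
change (is_derive (fun s => / r * (sigma s * cos (phi s) + h s * sin (phi s))) s
  (cos (phi s))).
pose proof (h_derive s) as Hh; pose proof (sigma_derive s) as Hs.
pose proof (phi_derive s) as Hp; clearbody h sigma phi.
auto_derive; [repeat split; eexists; [apply Hs | apply Hp | apply Hh | apply Hp] |].
rewrite_Derive Hh; rewrite_Derive Hs; rewrite_Derive Hp; field; lra.
Qed.

Let model_derive_im (s : R) :
  is_derive (fun s => Im (model r A t0 alpha s)) s (sin (phi s)).
Proof.
change (is_derive (fun s => / r * (sigma s * sin (phi s) + - (1) * (h s * cos (phi s)))) s
  (sin (phi s))).
pose proof (h_derive s) as Hh; pose proof (sigma_derive s) as Hs.
pose proof (phi_derive s) as Hp; clearbody h sigma phi.
auto_derive; [repeat split; eexists; [apply Hs | apply Hp | apply Hh | apply Hp] |].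
rewrite_Derive Hh; rewrite_Derive Hs; rewrite_Derive Hp; field; lra.
Qed.

Lemma model_velocity (s : R) :
  velocity (model r A t0 alpha) s =
  (cos (model_angle r A t0 alpha s), sin (model_angle r A t0 alpha s)).
Proof.
unfold velocity; f_equal; apply is_derive_unique;
  [apply model_derive_re | apply model_derive_im].
Qed.

Lemma model_unit_speed : unit_speed (model r A t0 alpha).
Proof.
(* The angle phi enters only through its cosine and sine; as phi' = r h, these four functions are
   closed under derivation up to polynomials. *)
set (G := fun f => f = h \/ f = sigma \/ f = (fun s => cos (phi s)) \/
                   f = (fun s => sin (phi s))).
assert (Hh : polynomials G h) by (apply polynomials_gen; now left).
assert (Hs : polynomials G sigma) by (apply polynomials_gen; now right; left).
assert (Hcos : polynomials G (fun s => cos (phi s)))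
  by (apply polynomials_gen; now right; right; left).
assert (Hsin : polynomials G (fun s => sin (phi s)))
  by (apply polynomials_gen; now right; right; right).
assert (HG : forall f, G f -> exists g, polynomials G g /\ forall x, is_derive f x (g x)).
  intros f [-> | [-> | [-> | ->]]]; eexists;
    (split; [| first [exact h_derive | exact sigma_derive | exact cos_derive
                     | exact sin_derive]]);
    repeat first [assumption | apply polynomials_const
                 | apply polynomials_plus | apply polynomials_mult].
split.
- intros n s; split; apply (polynomials_smooth G HG).
  + apply (polynomials_mult G (fun _ => / r)
      (fun s => sigma s * cos (phi s) + h s * sin (phi s)));
      repeat first [assumption | apply polynomials_const
                   | apply polynomials_plus | apply polynomials_mult].
  + apply (polynomials_mult G (fun _ => / r)
      (fun s => sigma s * sin (phi s) + - (1) * (h s * cos (phi s))));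
      repeat first [assumption | apply polynomials_const
                   | apply polynomials_plus | apply polynomials_mult].
- intros s; rewrite model_velocity; apply Cmod_of_sq; [lra |]; simpl.
  pose proof (sin2_cos2 (phi s)) as Hsc; unfold Rsqr in Hsc; fold (phi s); lra.
Qed.

Lemma model_curvature (s : R) :
  curvature (model r A t0 alpha) s = r * sol_h A (r * s + t0).
Proof.
rewrite curvature_unit_speed by apply model_unit_speed.
assert (Hvv : velocity (velocity (model r A t0 alpha)) s =
  (- (r * h s) * sin (phi s), r * h s * cos (phi s))).
  unfold velocity at 1; f_equal; apply is_derive_unique.
  - apply (is_derive_ext (fun s => cos (phi s)));
      [intros u; now rewrite model_velocity |].
    replace (- _ * _) with (r * (- (1) * (h s * sin (phi s)))) by ring; apply cos_derive.
  - apply (is_derive_ext (fun s => sin (phi s)));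
      [intros u; now rewrite model_velocity |].
    replace (r * _ * _) with (r * (h s * cos (phi s))) by ring; apply sin_derive.
rewrite Hvv, model_velocity, inner_eq; fold (phi s) (h s); simpl.
pose proof (sin2_cos2 (phi s)) as Hsc; unfold Rsqr in Hsc.
transitivity (r * h s * (sin (phi s) * sin (phi s) + cos (phi s) * cos (phi s)));
  [ring | rewrite Hsc; ring].
Qed.

Lemma model_pos_shrinker : pos_shrinker (- r ^ 2) (model r A t0 alpha).
Proof.
split; [apply model_unit_speed | split].
- intros s; rewrite model_curvature, normal_unit_speed, model_velocity, inner_eq
    by apply model_unit_speed.
  unfold model; fold (h s) (sigma s) (phi s); simpl.
  pose proof (sin2_cos2 (phi s)) as Hsc; unfold Rsqr in Hsc.
  transitivity (r * h s * (sin (phi s) * sin (phi s) + cos (phi s) * cos (phi s)));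
    [field; lra | rewrite Hsc; ring].
- intros s; rewrite model_curvature; apply Rmult_lt_0_compat; [lra | apply sol_h_pos].
Qed.

End Model.

(** ln h <= h - 1 gives (h - 1) ^ 2 <= A ^ 2, and 2 ln h <= h ^ 2 - 1 gives sigma ^ 2 <= A ^ 2.
    These bounds make the quadratic system Lipschitz along its solutions. *)
Lemma energy_bounds (A h sigma : R) :
  0 <= A -> 0 < h -> sigma ^ 2 + h ^ 2 - 2 * ln h = A ^ 2 + 1 ->
  h <= 1 + A /\ Rabs sigma <= A.
Proof.
intros hA hh HE.
pose proof (exp_ineq1_le (ln h)) as H1; rewrite exp_ln in H1 by exact hh.
pose proof (exp_ineq1_le (2 * ln h)) as H2.
replace (2 * ln h) with (ln h + ln h) in H2 by ring.
rewrite exp_plus, exp_ln in H2 by exact hh.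
split; [nra |]; apply Rabs_le; nra.
Qed.

Lemma solution_unique (r A : R) (h1 s1 h2 s2 : R -> R) :
  0 < r -> 0 <= A ->
  (forall s, 0 < h1 s /\ s1 s ^ 2 + h1 s ^ 2 - 2 * ln (h1 s) = A ^ 2 + 1) ->
  (forall s, 0 < h2 s /\ s2 s ^ 2 + h2 s ^ 2 - 2 * ln (h2 s) = A ^ 2 + 1) ->
  (forall s, is_derive h1 s (r * (h1 s * s1 s))) ->
  (forall s, is_derive s1 s (r * (1 - h1 s ^ 2))) ->
  (forall s, is_derive h2 s (r * (h2 s * s2 s))) ->
  (forall s, is_derive s2 s (r * (1 - h2 s ^ 2))) ->
  h1 0 = h2 0 -> s1 0 = s2 0 ->
  forall s, h1 s = h2 s /\ s1 s = s2 s.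
Proof.
intros hr hA HE1 HE2 Dh1 Ds1 Dh2 Ds2 H0 H0' s.
enough ((h1 s - h2 s) ^ 2 + (s1 s - s2 s) ^ 2 = 0) as HD.
  pose proof (pow2_ge_0 (h1 s - h2 s)); pose proof (pow2_ge_0 (s1 s - s2 s)).
  split; apply Rminus_diag_uniq, Rsqr_0_uniq; rewrite Rsqr_pow2; lra.
apply (gronwall_zero (fun s => (h1 s - h2 s) ^ 2 + (s1 s - s2 s) ^ 2)
  (fun s => 2 * r * ((h1 s - h2 s) * (h1 s * s1 s - h2 s * s2 s) -
                     (s1 s - s2 s) * (h1 s ^ 2 - h2 s ^ 2)))
  (8 * r * (1 + A))).
- intros u; apply Rplus_le_le_0_compat; apply pow2_ge_0.
- intros u; auto_derive.
    repeat split; eexists; [apply Dh1 | apply Dh2 | apply Ds1 | apply Ds2].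
  rewrite_Derive (Dh1 u); rewrite_Derive (Dh2 u).
  rewrite_Derive (Ds1 u); rewrite_Derive (Ds2 u); ring.
- intros u.
  destruct (HE1 u) as [p1 e1]; destruct (HE2 u) as [p2 e2].
  destruct (energy_bounds A _ _ hA p1 e1) as [b1 c1].
  destruct (energy_bounds A _ _ hA p2 e2) as [b2 c2].
  apply Rabs_le_between in c1; apply Rabs_le_between in c2.
  set (a := h1 u - h2 u); set (b := s1 u - s2 u).
  (* The terms in h1 a b cancel, leaving a quadratic form in (a, b) whose coefficients are
     controlled by [energy_bounds]. *)
  replace (a * (h1 u * s1 u - h2 u * s2 u) - b * (h1 u ^ 2 - h2 u ^ 2))
    with (s2 u * a ^ 2 - h2 u * (a * b)) by (unfold a, b; ring).
  rewrite Rabs_mult, (Rabs_pos_eq (2 * r)) by lra.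
  replace (8 * r * (1 + A) * (a ^ 2 + b ^ 2))
    with (2 * r * (4 * (1 + A) * (a ^ 2 + b ^ 2))) by ring.
  apply Rmult_le_compat_l; [lra |].
  pose proof (pow2_ge_0 (a + b)); pose proof (pow2_ge_0 (a - b)).
  pose proof (pow2_ge_0 a); pose proof (pow2_ge_0 b).
  clearbody a b; clear - hA p2 b2 c2 H H1 H2 H3.
  apply Rabs_le; split; nra.
- rewrite H0, H0'; ring.
Qed.

(** Differentiating |T| ^ 2 = 1 shows that T' is orthogonal to T, hence equal to k N. The real
    coordinates are exposed so that later arguments only differentiate real functions. *)
Lemma frenet_frame (X : R -> C) :
  unit_speed X ->
  exists x y a b : R -> R,
    (forall s, X s = (x s, y s)) /\ (forall s, velocity X s = (a s, b s)) /\
    (forall s, is_derive x s (a s)) /\ (forall s, is_derive y s (b s)) /\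
    (forall s, is_derive a s (- curvature X s * b s)) /\
    (forall s, is_derive b s (curvature X s * a s)) /\
    (forall s, a s ^ 2 + b s ^ 2 = 1) /\
    (forall s, inner (X s) (normal X s) = y s * a s - x s * b s).
Proof.
intros HX.
set (x := fun s => Re (X s)); set (y := fun s => Im (X s)).
set (a := Derive x); set (b := Derive y).
set (a' := Derive a); set (b' := Derive b).
assert (Dx : forall s, is_derive x s (a s))
  by (intros s; apply Derive_correct, (proj1 (proj1 HX 1%nat s))).
assert (Dy : forall s, is_derive y s (b s))
  by (intros s; apply Derive_correct, (proj2 (proj1 HX 1%nat s))).
assert (Da : forall s, is_derive a s (a' s))
  by (intros s; apply Derive_correct, (proj1 (proj1 HX 2%nat s))).
assert (Db : forall s, is_derive b s (b' s))
  by (intros s; apply Derive_correct, (proj2 (proj1 HX 2%nat s))).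
assert (Hab : forall s, a s ^ 2 + b s ^ 2 = 1).
  intros s; pose proof (Cmod_sq (velocity X s)) as H.
  rewrite (proj2 HX s) in H; simpl in H |- *; unfold a, b, x, y; lra.
assert (Hab' : forall s, a s * a' s + b s * b' s = 0).
  intros s.
  assert (D1 : is_derive (fun s => a s ^ 2 + b s ^ 2) s (2 * (a s * a' s + b s * b' s))).
    clearbody a' b'; clearbody a b; auto_derive.
      repeat split; eexists; [apply Da | apply Db].
    rewrite_Derive (Da s); rewrite_Derive (Db s); ring.
  assert (D2 : is_derive (fun s => a s ^ 2 + b s ^ 2) s 0).
    apply (is_derive_ext (fun _ => 1)); [intros; symmetry; apply Hab |].
    apply (@is_derive_const R_AbsRing R_NormedModule).
  apply is_derive_unique in D1; apply is_derive_unique in D2; lra.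
assert (Hk : forall s, curvature X s = a s * b' s - a' s * b s).
  intros s; rewrite curvature_unit_speed, inner_eq by exact HX.
  change (velocity (velocity X) s) with (a' s, b' s).
  change (velocity X s) with (a s, b s); simpl; ring.
exists x, y, a, b.
split; [| split; [reflexivity | split; [| split; [| split; [| split; [| split]]]]]];
  try assumption.
- intros s; unfold x, y; now destruct (X s).
- intros s; replace (- curvature X s * b s) with (a' s); [apply Da |]; rewrite Hk.
  transitivity (a' s * (a s ^ 2 + b s ^ 2) - a s * (a s * a' s + b s * b' s));
    [rewrite Hab, Hab'; ring | ring].
- intros s; replace (curvature X s * a s) with (b' s); [apply Db |]; rewrite Hk.
  transitivity (b' s * (a s ^ 2 + b s ^ 2) - b s * (a s * a' s + b s * b' s));
    [rewrite Hab, Hab'; ring | ring].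
- intros s; rewrite normal_unit_speed, inner_eq by exact HX.
  change (velocity X s) with (a s, b s); fold (x s) (y s); simpl; ring.
Qed.

(** The components of X in its frame solve the system for h and sigma. Their energy determines A and
    their initial values the phase, so uniqueness identifies them with the explicit solution; only a
    constant rotation of the frame remains. *)
Lemma pos_shrinker_is_model (r : R) (X : R -> C) :
  0 < r -> pos_shrinker (- r ^ 2) X ->
  exists A t0 alpha, 0 <= A /\ forall s, X s = model r A t0 alpha s.
Proof.
intros hr [HX [HB Hpos]].
destruct (frenet_frame X HX) as (x & y & a & b & HXx & _ & Dx & Dy & Da & Db & Hab & HN).
set (h := fun s => r * (x s * b s - y s * a s)).
set (sigma := fun s => r * (x s * a s + y s * b s)).
assert (Hk : forall s, curvature X s = r * h s)
  by (intros s; rewrite <- HB, HN; unfold h; ring).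
assert (hh : forall s, 0 < h s) by (intros s; pose proof (Hpos s) as H; rewrite Hk in H; nra).
assert (Dh : forall s, is_derive h s (r * (h s * sigma s))).
  intros s; unfold h at 1; auto_derive.
    repeat split; eexists; [apply Dx | apply Db | apply Dy | apply Da].
  rewrite_Derive (Dx s); rewrite_Derive (Db s).
  rewrite_Derive (Dy s); rewrite_Derive (Da s).
  rewrite Hk; unfold sigma; ring.
assert (Ds : forall s, is_derive sigma s (r * (1 - h s ^ 2))).
  intros s; unfold sigma; auto_derive.
    repeat split; eexists; [apply Dx | apply Da | apply Dy | apply Db].
  rewrite_Derive (Dx s); rewrite_Derive (Db s).
  rewrite_Derive (Dy s); rewrite_Derive (Da s).
  rewrite Hk; transitivity (r * (a s ^ 2 + b s ^ 2 - h s ^ 2));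
    [unfold h; ring | now rewrite Hab].
assert (Hx : forall s, x s = / r * (sigma s * a s + h s * b s)).
  intros s; unfold sigma, h.
  transitivity (x s * (a s ^ 2 + b s ^ 2)); [rewrite Hab; ring | field; lra].
assert (Hy : forall s, y s = / r * (sigma s * b s + - (1) * (h s * a s))).
  intros s; unfold sigma, h.
  transitivity (y s * (a s ^ 2 + b s ^ 2)); [rewrite Hab; ring | field; lra].
clearbody h sigma.
set (en := fun s => sigma s ^ 2 + h s ^ 2 - 2 * ln (h s)).
assert (Hen : forall s, en s = en 0).
  intros s; apply (derive_0_const en); clear s; intros s; unfold en; auto_derive.
    repeat split; [eexists; apply Ds | eexists; apply Dh | eexists; apply Dh | apply hh].
  rewrite_Derive (Dh s); rewrite_Derive (Ds s); field; apply Rgt_not_eq, hh.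
pose proof (amp_sq (ln (h 0))) as Hamp.
replace (2 * ln (h 0)) with (ln (h 0) + ln (h 0)) in Hamp at 1 by ring.
rewrite exp_plus, exp_ln in Hamp by apply hh.
(* By [amp_sq], en 0 - 1 is the sum of squares sigma ^ 2 + amp (ln h) ^ 2 at time 0, so (sigma, amp
   (ln h)) has polar coordinates (A, p). *)
set (A := sqrt (en 0 - 1)).
assert (HA : A ^ 2 = sigma 0 ^ 2 + amp (ln (h 0)) ^ 2).
  unfold A; rewrite pow2_sqrt; unfold en; nra.
assert (hA : 0 <= A) by apply sqrt_pos.
assert (Hphase : exists p, A * cos p = sigma 0 /\ A * sin p = amp (ln (h 0))).
  destruct hA as [hA | hA].
  - destruct (unit_circle_angle (sigma 0 / A) (amp (ln (h 0)) / A)) as [p [Hc Hsn]].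
      unfold Rdiv; rewrite !Rpow_mult_distr, <- Rmult_plus_distr_r, <- HA.
      field; lra.
    exists p; rewrite Hc, Hsn; split; field; lra.
  - exists 0; rewrite <- hA in *; split; nra.
destruct Hphase as [p [Hc Hsn]].
exists A, (arc A p).
assert (Hp : phase A (arc A p) = p) by apply phase_arc, hA.
assert (Heq : forall s, h s = sol_h A (r * s + arc A p) /\
                        sigma s = sol_sigma A (r * s + arc A p)).
  apply (solution_unique r A); try assumption.
  - intros s; split; [apply hh |]; fold (en s); rewrite Hen; unfold A.
    rewrite pow2_sqrt; [ring | unfold en; nra].
  - intros s; split; [apply sol_h_pos | apply sol_energy].
  - intros s; pose proof (sol_h_derive A hA (r * s + arc A p)) as H.
    auto_derive; [eexists; apply H |]; rewrite_Derive H; ring.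
  - intros s; pose proof (sol_sigma_derive A hA (r * s + arc A p)) as H.
    auto_derive; [eexists; apply H |]; rewrite_Derive H; ring.
  - unfold sol_h; rewrite Rmult_0_r, Rplus_0_l, Hp, Hsn, zeta_amp, exp_ln; auto.
  - unfold sol_sigma; now rewrite Rmult_0_r, Rplus_0_l, Hp.
set (th := fun s => sol_theta A (r * s + arc A p)).
assert (Dth : forall s, is_derive th s (r * h s)).
  intros s; pose proof (sol_theta_derive A hA (r * s + arc A p)) as H.
  unfold th; auto_derive; [eexists; apply H |]; rewrite_Derive H.
  rewrite (proj1 (Heq s)); ring.
(* w1 + i w2 is T times exp (- i theta). It is constant because T and theta turn at the same rate,
   and its argument is alpha. *)
set (w1 := fun s => a s * cos (th s) + b s * sin (th s)).
set (w2 := fun s => b s * cos (th s) - a s * sin (th s)).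
assert (Hw1 : forall s, w1 s = w1 0).
  intros s; apply (derive_0_const w1); clear s; intros s; unfold w1; clearbody th; auto_derive.
    repeat split; eexists; [apply Da | apply Dth | apply Db | apply Dth].
  rewrite_Derive (Da s); rewrite_Derive (Db s); rewrite_Derive (Dth s).
  rewrite Hk; ring.
assert (Hw2 : forall s, w2 s = w2 0).
  intros s; apply (derive_0_const w2); clear s; intros s; unfold w2; clearbody th; auto_derive.
    repeat split; eexists; [apply Db | apply Dth | apply Da | apply Dth].
  rewrite_Derive (Da s); rewrite_Derive (Db s); rewrite_Derive (Dth s).
  rewrite Hk; ring.
destruct (unit_circle_angle (w1 0) (w2 0)) as [alpha [Hca Hsa]].
  pose proof (sin2_cos2 (th 0)) as Hsc; unfold Rsqr in Hsc; unfold w1, w2.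
  transitivity ((a 0 ^ 2 + b 0 ^ 2) *
    (sin (th 0) * sin (th 0) + cos (th 0) * cos (th 0))); [ring | rewrite Hsc, Hab; ring].
exists alpha; split; [exact hA |]; intros s.
pose proof (sin2_cos2 (th s)) as Hsc; unfold Rsqr in Hsc.
assert (Hcos : cos (model_angle r A (arc A p) alpha s) = a s).
  unfold model_angle; fold (th s); rewrite cos_plus, Hca, Hsa, <- (Hw1 s), <- (Hw2 s).
  unfold w1, w2.
  transitivity (a s * (sin (th s) * sin (th s) + cos (th s) * cos (th s)));
    [ring | rewrite Hsc; ring].
assert (Hsin : sin (model_angle r A (arc A p) alpha s) = b s).
  unfold model_angle; fold (th s); rewrite sin_plus, Hca, Hsa, <- (Hw1 s), <- (Hw2 s).
  unfold w1, w2.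
  transitivity (b s * (sin (th s) * sin (th s) + cos (th s) * cos (th s)));
    [ring | rewrite Hsc; ring].
unfold model; rewrite Hcos, Hsin, <- (proj1 (Heq s)), <- (proj2 (Heq s)), HXx, Hx, Hy.
reflexivity.
Qed.

(** * Classification of shrinkers *)

Lemma reverse_reverse (X : R -> C) : reverse (reverse X) = X.
Proof. apply functional_extensionality; intros s; unfold reverse; now rewrite Ropp_involutive. Qed.

Lemma velocity_reverse (X : R -> C) (s : R) :
  smooth X -> velocity (reverse X) s = (- velocity X (- s))%C.
Proof.
intros HX; destruct (HX 1%nat (- s)) as [Hx Hy].
assert (H : forall x : R -> R, ex_derive x (- s) ->
    Derive (fun u => x (- u)) s = - Derive x (- s)).
  intros x Hd; apply is_derive_unique; auto_derive; [exact Hd |].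
  change (fun x0 : R => x x0) with x; ring.
unfold velocity, reverse; apply injective_projections;
  [apply (H (fun u => Re (X u))) | apply (H (fun u => Im (X u)))]; assumption.
Qed.

Lemma smooth_opp (X : R -> C) : smooth X -> smooth (fun s => (- X s)%C).
Proof.
intros HX n s; destruct (HX n s); split; now apply ex_derive_n_opp.
Qed.

Lemma velocity_opp (X : R -> C) (s : R) :
  velocity (fun s => (- X s)%C) s = (- velocity X s)%C.
Proof. unfold velocity; apply injective_projections; simpl; apply Derive_opp. Qed.

Lemma smooth_velocity (X : R -> C) : smooth X -> smooth (velocity X).
Proof.
intros HX n s; destruct (HX (S n) s) as [Hx Hy].
destruct n as [| n]; [split; exact I |].
split; [apply (ex_derive_ext (Derive_n (fun u => Re (X u)) (S n)))
       | apply (ex_derive_ext (Derive_n (fun u => Im (X u)) (S n)))];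
  try assumption; intros t; rewrite <- Nat.add_1_r; symmetry; apply (Derive_n_comp _ n 1).
Qed.

Lemma reverse_unit_speed (X : R -> C) : unit_speed X -> unit_speed (reverse X).
Proof.
intros [HX Hv]; split.
- intros n s; unfold reverse; split.
  + apply (ex_derive_n_comp_opp (fun u => Re (X u))), filter_forall; intros y k _; apply HX.
  + apply (ex_derive_n_comp_opp (fun u => Im (X u))), filter_forall; intros y k _; apply HX.
- intros s; rewrite velocity_reverse by exact HX; now rewrite Cmod_opp.
Qed.

Lemma normal_reverse (X : R -> C) (s : R) :
  unit_speed X -> normal (reverse X) s = (- normal X (- s))%C.
Proof.
intros HX; rewrite !normal_unit_speed by (exact HX || now apply reverse_unit_speed).
rewrite velocity_reverse by apply HX; ring.
Qed.

Lemma curvature_reverse (X : R -> C) (s : R) :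
  unit_speed X -> curvature (reverse X) s = - curvature X (- s).
Proof.
intros HX; pose proof (reverse_unit_speed X HX) as HR.
rewrite curvature_unit_speed, <- normal_unit_speed, normal_reverse by assumption.
rewrite (curvature_unit_speed X), <- (normal_unit_speed X) by assumption.
replace (velocity (reverse X)) with (reverse (fun s => (- velocity X s)%C)).
- rewrite velocity_reverse by apply smooth_opp, smooth_velocity, HX.
  rewrite velocity_opp, !inner_eq; simpl; ring.
- apply functional_extensionality; intros u; now rewrite velocity_reverse by apply HX.
Qed.

Lemma reverse_shrinker_eq (B : R) (X : R -> C) :
  unit_speed X ->
  (forall s, B * inner (X s) (normal X s) = curvature X s) ->
  forall s, B * inner (reverse X s) (normal (reverse X) s) = curvature (reverse X) s.
Proof.
intros HX HB s; rewrite curvature_reverse, normal_reverse, <- HB by exact HX.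
unfold reverse; rewrite !inner_eq; simpl; ring.
Qed.

Lemma shrinker_flat_line (B : R) (X : R -> C) :
  unit_speed X -> (forall s, inner (X s) (normal X s) = 0) ->
  (forall s, curvature X s = 0) -> line_through_origin X.
Proof.
intros HX HN Hk.
destruct (frenet_frame X HX) as (x & y & a & b & HXx & _ & Dx & Dy & Da & Db & Hab & HN').
assert (Ha : forall s, a s = a 0).
  intros s; apply (derive_0_const a); intros u.
  replace 0 with (- curvature X u * b u) by (rewrite Hk; ring); apply Da.
assert (Hb : forall s, b s = b 0).
  intros s; apply (derive_0_const b); intros u.
  replace 0 with (curvature X u * a u) by (rewrite Hk; ring); apply Db.
assert (H0 : y 0 * a 0 - x 0 * b 0 = 0) by (rewrite <- HN'; apply HN).
assert (H1 := Hab 0).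
assert (Hx : forall s, x s = x 0 + s * a 0).
  intros s; enough (x s - s * a 0 = x 0 - 0 * a 0) by lra.
  apply (derive_0_const (fun s => x s - s * a 0)); intros u; auto_derive.
    now eexists; apply Dx.
  rewrite_Derive (Dx u); rewrite (Ha u); ring.
assert (Hy : forall s, y s = y 0 + s * b 0).
  intros s; enough (y s - s * b 0 = y 0 - 0 * b 0) by lra.
  apply (derive_0_const (fun s => y s - s * b 0)); intros u; auto_derive.
    now eexists; apply Dy.
  rewrite_Derive (Dy u); rewrite (Hb u); ring.
(* Since <X, N> = 0, the initial point is c T with c = <X, T>, so the straight line passes through
   the origin. *)
set (c := x 0 * a 0 + y 0 * b 0).
assert (Hxc : x 0 = c * a 0).
  unfold c; transitivity (x 0 * (a 0 ^ 2 + b 0 ^ 2) + b 0 * (y 0 * a 0 - x 0 * b 0));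
    [rewrite H0, H1; ring | ring].
assert (Hyc : y 0 = c * b 0).
  unfold c; transitivity (y 0 * (a 0 ^ 2 + b 0 ^ 2) - a 0 * (y 0 * a 0 - x 0 * b 0));
    [rewrite H0, H1; ring | ring].
clearbody c.
exists (a 0, b 0); split.
- intros H; injection H; intros Hb0 Ha0; rewrite Ha0, Hb0 in H1; lra.
- intros z; split.
  + intros [s <-]; exists (c + s); rewrite HXx, Hx, Hy, Hxc, Hyc.
    apply injective_projections; simpl; ring.
  + intros [u ->]; exists (u - c); rewrite HXx, Hx, Hy, Hxc, Hyc.
    apply injective_projections; simpl; ring.
Qed.

(* [nu = <X, N>] satisfies [nu' = - B tau nu] with [tau = <X, T> = (|X| ^ 2 / 2)'],
   so [nu exp (B |X| ^ 2 / 2)] is constant and [nu] keeps its sign. *)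
Lemma weighted_support_constant (B : R) (X : R -> C) :
  unit_speed X ->
  (forall s, B * inner (X s) (normal X s) = curvature X s) ->
  exists c, forall s,
    inner (X s) (normal X s) * exp (B * Cmod (X s) ^ 2 / 2) = c.
Proof.
intros HX HB.
destruct (frenet_frame X HX) as (x & y & a & b & HXx & _ & Dx & Dy & Da & Db & Hab & HN).
set (f := fun s => (y s * a s - x s * b s) * exp (B * (x s ^ 2 + y s ^ 2) / 2)).
exists (f 0); intros s; rewrite HN, Cmod_sq, HXx; simpl Re; simpl Im; fold (f s).
apply derive_0_const; clear s; intros s; unfold f; auto_derive.
  repeat split; eexists; [apply Dy | apply Da | apply Dx | apply Db | apply Dx | apply Dy].
rewrite_Derive (Dx s); rewrite_Derive (Dy s); rewrite_Derive (Da s); rewrite_Derive (Db s).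
rewrite <- HB, HN; field.
Qed.

(** The sign of the constant in [weighted_support_constant] is opposite to that of k, as B < 0; the
    value 0 would make the curve a line through the origin. *)
Lemma shrinker_orientation (B : R) (X : R -> C) :
  B < 0 -> shrinker B X -> pos_shrinker B X \/ pos_shrinker B (reverse X).
Proof.
intros hB [HX [HB HL]].
destruct (weighted_support_constant B X HX HB) as [c Hc].
assert (He : forall s, 0 < exp (B * Cmod (X s) ^ 2 / 2)) by (intros; apply exp_pos).
destruct (Rtotal_order c 0) as [h | [h | h]].
- left; split; [exact HX | split; [exact HB |]]; intros s.
  specialize (Hc s); specialize (He s); rewrite <- HB; nra.
- exfalso; apply HL, (shrinker_flat_line B X HX).
  + intros s; specialize (Hc s); specialize (He s); nra.
  + intros s; rewrite <- HB; specialize (Hc s); specialize (He s).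
    replace (inner (X s) (normal X s)) with 0 by nra; ring.
- right; split; [now apply reverse_unit_speed | split; [now apply reverse_shrinker_eq |]].
  intros s; rewrite curvature_reverse, <- HB by exact HX.
  specialize (Hc (- s)); specialize (He (- s)); nra.
Qed.

Lemma shrinker_classification (r : R) (X : R -> C) :
  0 < r -> shrinker (- r ^ 2) X ->
  exists A t0 alpha, 0 <= A /\
    (X = model r A t0 alpha \/ X = reverse (model r A t0 alpha)).
Proof.
intros hr HX.
destruct (shrinker_orientation (- r ^ 2) X ltac:(nra) HX) as [H | H];
  destruct (pos_shrinker_is_model r _ hr H) as (A & t0 & alpha & hA & HM);
  exists A, t0, alpha; split; try exact hA; [left | right].
- now apply functional_extensionality.
- rewrite <- (reverse_reverse X); f_equal; now apply functional_extensionality.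
Qed.

(** * Radius and excursions *)

Lemma quasi_period_Z (f : R -> R) (T c : R) :
  (forall x, f (x + T) = f x + c) ->
  forall (j : Z) x, f (x + IZR j * T) = f x + IZR j * c.
Proof.
intros H j; induction j as [| j Hj | j Hj] using Z.peano_ind; intros x.
- now rewrite !Rmult_0_l, !Rplus_0_r.
- rewrite succ_IZR; replace (x + (IZR j + 1) * T) with (x + IZR j * T + T) by ring.
  rewrite H, Hj; ring.
- specialize (Hj x); specialize (H (x + IZR (Z.pred j) * T)).
  rewrite <- Z.sub_1_r, minus_IZR in *.
  replace (x + (IZR j - 1) * T + T) with (x + IZR j * T) in H by ring.
  rewrite Hj in H; lra.
Qed.

Lemma cos_sin_period_Z (x : R) (k : Z) :
  cos (x + IZR k * (2 * PI)) = cos x /\ sin (x + IZR k * (2 * PI)) = sin x.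
Proof.
split.
- rewrite (quasi_period_Z cos _ 0); [ring |].
  intros u; rewrite cos_plus, cos_2PI, sin_2PI; ring.
- rewrite (quasi_period_Z sin _ 0); [ring |].
  intros u; rewrite sin_plus, cos_2PI, sin_2PI; ring.
Qed.

Lemma cos_eq_1 (x : R) : cos x = 1 -> exists k : Z, x = IZR k * (2 * PI).
Proof.
intros H; pose proof (cos_2a_sin (x / 2)) as H2.
replace (2 * (x / 2)) with x in H2 by field.
destruct (sin_eq_0_0 (x / 2)) as [k Hk]; [nra |].
exists k; lra.
Qed.

Lemma sin_eq_1 (x : R) : sin x = 1 -> exists k : Z, x = PI / 2 + IZR k * (2 * PI).
Proof.
intros H; destruct (cos_eq_1 (PI / 2 - x)) as [k Hk].
  now rewrite cos_shift.
exists (- k)%Z; rewrite opp_IZR; lra.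
Qed.

Lemma sin_eq_m1 (x : R) : sin x = -1 -> exists k : Z, x = - (PI / 2) + IZR k * (2 * PI).
Proof.
intros H; destruct (sin_eq_1 (- x)) as [k Hk]; [rewrite sin_neg; lra |].
exists (- k)%Z; rewrite opp_IZR; lra.
Qed.

Definition expi (t : R) : C := (cos t, sin t).

Lemma Cmod_expi (t : R) : Cmod (expi t) = 1.
Proof.
apply Cmod_of_sq; [lra |]; simpl; pose proof (sin2_cos2 t) as H; unfold Rsqr in H; lra.
Qed.

Lemma expi_plus (s t : R) : expi (s + t) = (expi s * expi t)%C.
Proof.
unfold expi; rewrite cos_plus, sin_plus; apply injective_projections; simpl; ring.
Qed.

Lemma expi_period_Z (t : R) (k : Z) : expi (t + IZR k * (2 * PI)) = expi t.
Proof. unfold expi; now rewrite (proj1 (cos_sin_period_Z t k)), (proj2 (cos_sin_period_Z t k)). Qed.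

Lemma expi_eq_1 (t : R) : expi t = RtoC 1 -> exists k : Z, t = IZR k * (2 * PI).
Proof. intros H; injection H; intros _ Hc; now apply cos_eq_1. Qed.

Lemma expi_eq (s t : R) : expi s = expi t -> exists k : Z, s = t + IZR k * (2 * PI).
Proof.
intros H; destruct (expi_eq_1 (s + - t)) as [k Hk].
  rewrite expi_plus, H, <- expi_plus; replace (t + - t) with 0 by ring.
  unfold expi; now rewrite cos_0, sin_0.
exists k; lra.
Qed.

Lemma polar_form (z : C) : exists t, z = (RtoC (Cmod z) * expi t)%C.
Proof.
destruct (Req_dec (Cmod z) 0) as [H | H].
  exists 0; rewrite H, (Cmod_eq_0 z H); ring.
destruct (unit_circle_angle (Re z / Cmod z) (Im z / Cmod z)) as [t [Hc Hs]].
  unfold Rdiv; rewrite !Rpow_mult_distr, <- Rmult_plus_distr_r, <- Cmod_sq; field; lra.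
exists t; unfold expi; rewrite Hc, Hs.
apply injective_projections; simpl; unfold Re, Im; field; lra.
Qed.

(** At the radial extrema sigma = 0, so r |X| = h, with log h = zeta (- A) inside and zeta A
    outside. *)
Definition inner_radius (r A : R) : R := exp (zeta (- A)) / r.

Definition outer_radius (r A : R) : R := exp (zeta A) / r.

(** Conservation of energy: r ^ 2 |X| ^ 2 = sigma ^ 2 + h ^ 2 = A ^ 2 + 1 + 2 log h, as a function
    of y = A sin p. *)
Definition radius (r A y : R) : R := sqrt (A ^ 2 + 1 + 2 * zeta y) / r.

Section Radius.

Context (r A : R) (hr : 0 < r) (hA : 0 <= A).

Lemma radius_inner : radius r A (- A) = inner_radius r A.
Proof.
unfold radius, inner_radius; pose proof (zeta_energy (- A)) as H.
replace (A ^ 2 + 1 + 2 * zeta (- A)) with (exp (zeta (- A)) ^ 2)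
  by (rewrite <- exp_zeta_double; nra).
now rewrite sqrt_pow2 by (left; apply exp_pos).
Qed.

Lemma radius_outer : radius r A A = outer_radius r A.
Proof.
unfold radius, outer_radius; pose proof (zeta_energy A) as H.
replace (A ^ 2 + 1 + 2 * zeta A) with (exp (zeta A) ^ 2)
  by (rewrite <- exp_zeta_double; nra).
now rewrite sqrt_pow2 by (left; apply exp_pos).
Qed.

Lemma radicand_pos (y : R) : - A <= y -> 0 < A ^ 2 + 1 + 2 * zeta y.
Proof.
intros h; apply zeta_nondecreasing in h.
pose proof (zeta_energy (- A)); pose proof (exp_pos (2 * zeta (- A))); nra.
Qed.

Lemma radius_increasing (y1 y2 : R) : - A <= y1 -> y1 < y2 -> radius r A y1 < radius r A y2.
Proof.
intros h1 h2; pose proof (radicand_pos y1 h1); apply zeta_increasing in h2.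
apply Rmult_lt_compat_r; [now apply Rinv_0_lt_compat |].
apply sqrt_lt_1_alt; lra.
Qed.

Lemma radius_nondecreasing (y1 y2 : R) :
  - A <= y1 -> y1 <= y2 -> radius r A y1 <= radius r A y2.
Proof. intros h1 [h2 | ->]; [left; now apply radius_increasing | lra]. Qed.

Lemma radius_inj (y1 y2 : R) :
  - A <= y1 -> - A <= y2 -> radius r A y1 = radius r A y2 -> y1 = y2.
Proof.
intros h1 h2 H; destruct (Rtotal_order y1 y2) as [h | [h | h]]; [| exact h |];
  apply radius_increasing in h; lra.
Qed.

Lemma inner_radius_pos : 0 < inner_radius r A.
Proof. apply Rdiv_lt_0_compat; [apply exp_pos | exact hr]. Qed.

Lemma radius_onto (rho : R) :
  inner_radius r A <= rho <= outer_radius r A ->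
  exists y, - A <= y <= A /\ radius r A y = rho.
Proof.
intros [h1 h2]; pose proof inner_radius_pos.
(* The equation for the radius solved for zeta y. *)
exists (amp (((r * rho) ^ 2 - A ^ 2 - 1) / 2)).
set (y := amp _).
assert (Hy : radius r A y = rho).
  unfold radius, y; rewrite zeta_amp.
  replace (A ^ 2 + 1 + _) with ((r * rho) ^ 2) by field.
  rewrite sqrt_pow2 by nra; field; lra.
split; [| exact Hy].
rewrite <- radius_inner in h1; rewrite <- radius_outer in h2.
assert (hy : - A <= y).
  (* [radius_increasing] starts at - A, so a smaller y is excluded by comparing radicands. *)
  destruct (Rle_or_lt (- A) y) as [h | h]; [exact h | exfalso].
  apply zeta_increasing in h; unfold y in h; rewrite zeta_amp in h.
  pose proof (radicand_pos (- A) ltac:(lra)) as hp.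
  assert (hs : sqrt (A ^ 2 + 1 + 2 * zeta (- A)) <= r * rho).
    apply (Rmult_le_compat_l r) in h1; [| lra]; unfold radius in h1.
    replace (r * _) with (sqrt (A ^ 2 + 1 + 2 * zeta (- A))) in h1 by (field; lra).
    exact h1.
  pose proof (sqrt_lt_R0 _ hp); pose proof (pow2_sqrt _ (Rlt_le _ _ hp)); nra.
split; [exact hy |].
destruct (Rle_or_lt y A) as [h | h]; [exact h | exfalso].
apply radius_increasing in h; lra.
Qed.

Context (t0 alpha : R).

Let X := model r A t0 alpha.
Let psi (s : R) : R := phase A (r * s + t0).

Lemma model_radius (s : R) : Cmod (X s) = radius r A (A * sin (psi s)).
Proof.
pose proof (A_sin_bound A (psi s) hA) as hb.
apply Cmod_of_sq; [apply Rdiv_le_0_compat; [apply sqrt_pos | lra] |].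
unfold radius, Rdiv; rewrite Rpow_mult_distr, pow2_sqrt
  by (left; apply radicand_pos; lra).
pose proof (sol_energy A (r * s + t0)) as He.
unfold sol_h in He at 2; rewrite ln_exp in He; fold (psi s) in He.
unfold X, model; simpl Re; simpl Im.
set (h := sol_h _ _) in *; set (sg := sol_sigma _ _) in *; set (phi := model_angle _ _ _ _ _).
pose proof (sin2_cos2 phi) as Hsc; unfold Rsqr in Hsc.
transitivity ((sg ^ 2 + h ^ 2) * (sin phi * sin phi + cos phi * cos phi) * (/ r) ^ 2);
  [ring | rewrite Hsc; f_equal; lra].
Qed.

Lemma psi_at (p : R) : psi ((arc A p - t0) / r) = p.
Proof.
unfold psi; replace (r * ((arc A p - t0) / r) + t0) with (arc A p) by (field; lra).
apply phase_arc, hA.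
Qed.

Lemma psi_increasing (s t : R) : s < t -> psi s < psi t.
Proof. intros h; apply phase_increasing; [exact hA |]; nra. Qed.

Lemma psi_shift (s : R) (j : Z) :
  psi (s + IZR j * (arc_period A / r)) = psi s + IZR j * (2 * PI).
Proof.
unfold psi; replace (r * (s + IZR j * (arc_period A / r)) + t0)
  with (r * s + t0 + IZR j * arc_period A) by (field; lra).
apply quasi_period_Z; intros; apply phase_period, hA.
Qed.

Lemma model_annulus : annulus_radii X (inner_radius r A) (outer_radius r A).
Proof.
rewrite <- radius_inner, <- radius_outer; split; [| split].
- intros s; rewrite model_radius; pose proof (A_sin_bound A (psi s) hA).
  split; apply radius_nondecreasing; lra.
- exists ((arc A (- (PI / 2)) - t0) / r); rewrite model_radius, psi_at.
  f_equal; rewrite sin_neg, sin_PI2; ring.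
- exists ((arc A (PI / 2) - t0) / r); rewrite model_radius, psi_at.
  f_equal; rewrite sin_PI2; ring.
Qed.

Lemma model_shrinker : shrinker (- r ^ 2) X.
Proof.
destruct (model_pos_shrinker r A t0 alpha hr hA) as [H1 [H2 _]].
split; [exact H1 | split; [exact H2 |]].
(* A line through the origin contains 0, which the positive inner radius forbids. *)
intros [e [_ H]]; destruct (proj2 (H (RtoC 0))) as [s Hs]; [exists 0; ring |].
pose proof (proj1 (proj1 model_annulus s)) as Hr.
rewrite Hs, Cmod_0 in Hr; pose proof inner_radius_pos; lra.
Qed.

(** Over one excursion the phase gains 2 PI, so h and sigma recur while the frame has turned by
    Theta. *)
Lemma model_shift (s : R) (j : Z) :
  X (s + IZR j * (arc_period A / r)) = (expi (IZR j * turning A) * X s)%C.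
Proof.
assert (Ht : r * (s + IZR j * (arc_period A / r)) + t0 =
             r * s + t0 + IZR j * arc_period A) by (field; lra).
assert (Hps : phase A (r * s + t0 + IZR j * arc_period A) =
              phase A (r * s + t0) + IZR j * (2 * PI))
  by (apply quasi_period_Z; intros; apply phase_period, hA).
unfold X, model, model_angle, sol_h, sol_sigma, expi; rewrite Ht, Hps.
rewrite (quasi_period_Z (sol_theta A) (arc_period A) (turning A))
  by (intros; apply sol_theta_period, hA).
destruct (cos_sin_period_Z (phase A (r * s + t0)) j) as [-> ->].
replace (sol_theta A (r * s + t0) + IZR j * turning A + alpha)
  with (IZR j * turning A + (sol_theta A (r * s + t0) + alpha)) by ring.
set (phi := sol_theta A (r * s + t0) + alpha); clearbody phi.
rewrite cos_plus, sin_plus; apply injective_projections; simpl; ring.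
Qed.

Section Noncircular.

Context (hA0 : 0 < A).

Lemma model_inner_times (s : R) :
  Cmod (X s) = inner_radius r A <->
  exists k : Z, s = (arc A (- (PI / 2)) - t0) / r + IZR k * (arc_period A / r).
Proof.
rewrite model_radius, <- radius_inner; split.
- intros H; apply radius_inj in H; [| apply A_sin_bound; lra | lra].
  destruct (sin_eq_m1 (psi s)) as [k Hk].
    apply Rmult_eq_reg_l with A; lra.
  exists k; rewrite <- (psi_at (- (PI / 2))), <- psi_shift in Hk.
  destruct (Rtotal_order s ((arc A (- (PI / 2)) - t0) / r + IZR k * (arc_period A / r)))
    as [h | [h | h]]; [| exact h |]; apply psi_increasing in h; lra.
- intros [k ->]; rewrite psi_shift, psi_at, (proj2 (cos_sin_period_Z _ k)).
  f_equal; rewrite sin_neg, sin_PI2; ring.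
Qed.

Lemma model_outer_times (s : R) :
  Cmod (X s) = outer_radius r A <->
  exists k : Z, s = (arc A (PI / 2) - t0) / r + IZR k * (arc_period A / r).
Proof.
rewrite model_radius, <- radius_outer; split.
- intros H; apply radius_inj in H; [| apply A_sin_bound; lra | lra].
  destruct (sin_eq_1 (psi s)) as [k Hk].
    apply Rmult_eq_reg_l with A; lra.
  exists k; rewrite <- (psi_at (PI / 2)), <- psi_shift in Hk.
  destruct (Rtotal_order s ((arc A (PI / 2) - t0) / r + IZR k * (arc_period A / r)))
    as [h | [h | h]]; [| exact h |]; apply psi_increasing in h; lra.
- intros [k ->]; rewrite psi_shift, psi_at, (proj2 (cos_sin_period_Z _ k)).
  f_equal; rewrite sin_PI2; ring.
Qed.

Lemma inner_lt_outer : inner_radius r A < outer_radius r A.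
Proof. rewrite <- radius_inner, <- radius_outer; apply radius_increasing; lra. Qed.

Lemma model_excursions : identical_excursions X (inner_radius r A) (outer_radius r A).
Proof.
set (l := arc_period A / r).
assert (hl : 0 < l) by (apply Rdiv_lt_0_compat; [apply arc_period_pos | exact hr]).
set (so := (arc A (PI / 2) - t0) / r); set (si := (arc A (- (PI / 2)) - t0) / r).
assert (hsi : si < so < si + l).
  unfold si, so, l; pose proof PI_RGT_0.
  split.
  - apply Rmult_lt_compat_r; [now apply Rinv_0_lt_compat |].
    pose proof (arc_increasing A (- (PI / 2)) (PI / 2) ltac:(lra)); lra.
  - replace ((arc A (- (PI / 2)) - t0) / r + arc_period A / r)
      with ((arc A (- (PI / 2)) + arc_period A - t0) / r) by (field; lra).
    rewrite <- arc_period_spec.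
    apply Rmult_lt_compat_r; [now apply Rinv_0_lt_compat |].
    pose proof (arc_increasing A (PI / 2) (- (PI / 2) + 2 * PI) ltac:(lra)); lra.
exists so, l, (expi (turning A)); split; [exact hl | split; [apply Cmod_expi | split]].
(* Because si < so < si + l, the inner time inside excursion j has index j + 1. *)
- intros j; exists (si + IZR (j + 1) * l).
  assert (Hj : IZR (j + 1) = IZR j + 1) by apply plus_IZR.
  split; [rewrite Hj; lra |].
  split; [apply model_outer_times; now exists j |].
  split; [apply model_inner_times; now exists (j + 1)%Z |].
  split; [apply model_outer_times; exists (j + 1)%Z; now rewrite Hj |].
  intros s hs hne; destruct model_annulus as [Hb _]; destruct (Hb s) as [h1 h2].
  assert (Hk : forall k k' : Z, IZR k * l < IZR k' * l -> (k < k')%Z).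
    intros k k' h; apply lt_IZR, Rmult_lt_reg_r with l; assumption.
  split.
  + destruct h1 as [h1 | h1]; [exact h1 | exfalso].
    symmetry in h1; apply model_inner_times in h1; destruct h1 as [k ->].
    fold si l in hs, hne |- *.
    apply hne; f_equal; f_equal; f_equal.
    assert ((j < k)%Z) by (apply Hk; lra).
    assert ((k < j + 2)%Z) by (apply Hk; rewrite plus_IZR; lra).
    lia.
  + destruct h2 as [h2 | h2]; [exact h2 | exfalso].
    apply model_outer_times in h2; destruct h2 as [k ->].
    fold so l in hs.
    assert ((j < k)%Z) by (apply Hk; lra).
    assert ((k < j + 1)%Z) by (apply Hk; rewrite Hj; lra).
    lia.
- intros s; replace (s + l) with (s + IZR 1 * l) by ring; unfold l.
  rewrite model_shift; f_equal; f_equal; ring.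
Qed.

End Noncircular.

End Radius.

(** * Closed curves and dense curves *)

Lemma euclidean_quotient (x g : R) : 0 < g -> exists n : Z, 0 <= x - IZR n * g < g.
Proof.
intros hg; exists (up (x / g) - 1)%Z; rewrite minus_IZR.
destruct (archimed (x / g)) as [h1 h2].
assert (Hx : x = x / g * g) by (field; lra).
rewrite Hx at 1 3; split.
- replace (x / g * g - (IZR (up (x / g)) - 1) * g)
    with ((x / g - (IZR (up (x / g)) - 1)) * g) by ring.
  apply Rmult_le_pos; lra.
- replace (x / g * g - (IZR (up (x / g)) - 1) * g)
    with ((x / g - IZR (up (x / g))) * g + g) by ring.
  nra.
Qed.

(* A subgroup of the line generated by two incommensurable numbers has no least
   positive element. *)
Lemma kronecker_density (theta T : R) :
  0 < T -> (forall k m : Z, IZR k * theta = IZR m * T -> k = 0%Z) ->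
  forall beta eps, 0 < eps ->
  exists k m : Z, Rabs (IZR k * theta + IZR m * T - beta) < eps.
Proof.
intros hT Hinc beta eps heps.
set (G := fun x => exists k m : Z, x = IZR k * theta + IZR m * T).
assert (Gsub : forall x y (n : Z), G x -> G y -> G (x - IZR n * y)).
  intros x y n [k [m ->]] [k' [m' ->]].
  exists (k - n * k')%Z, (m - n * m')%Z; rewrite !minus_IZR, !mult_IZR; ring.
assert (GT : G T) by (exists 0%Z, 1%Z; ring).
assert (Gth : G theta) by (exists 1%Z, 0%Z; ring).
assert (Hsmall : exists g, G g /\ 0 < g < eps).
  apply Classical_Prop.NNPP; intros Hno.
  assert (Hbig : forall g, G g -> 0 < g -> eps <= g).
    intros g Gg hg; destruct (Rle_or_lt eps g) as [h | h]; [exact h | exfalso].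
    apply Hno; exists g; tauto.
  (* The supremum u of the negated positive elements; - u is the infimum of the positive elements of
     the group. *)
  destruct (completeness (fun x => G (- x) /\ x < 0)) as [u [Hub Hlub]].
  - exists (- eps); intros x [Gx hx]; specialize (Hbig _ Gx); lra.
  - exists (- T); rewrite Ropp_involutive; split; [exact GT | lra].
  - assert (Hle : forall g, G g -> 0 < g -> - u <= g).
      intros g Gg hg; enough (- g <= u) by lra.
      apply Hub; rewrite Ropp_involutive; split; [exact Gg | lra].
    assert (Hex : exists g, G g /\ 0 < g /\ g < - u + eps).
      apply Classical_Prop.NNPP; intros H.
      enough (u <= u - eps) by lra; apply Hlub; intros x [Gx hx].
      destruct (Rle_or_lt x (u - eps)) as [h | h]; [exact h | exfalso].
      apply H; exists (- x); repeat split; try assumption; lra.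
    destruct Hex as [g [Gg [hg hgu]]].
    (* A nonzero remainder d of x modulo g is at least - u, so g - d would be a positive element
       below eps. *)
    assert (Hmin : forall x, G x -> exists n : Z, x = IZR n * g).
      intros x Gx; destruct (euclidean_quotient x g hg) as [n [h1 h2]].
      exists n; destruct h1 as [h1 | h1]; [exfalso | lra].
      pose proof (Gsub x g n Gx Gg) as Gd; pose proof (Hle _ Gd h1).
      pose proof (Gsub g _ 1%Z Gg Gd) as Gd'; pose proof (Hbig _ Gd').
      lra.
    destruct (Hmin T GT) as [n Hn]; destruct (Hmin theta Gth) as [n' Hn'].
    (* T = n g and theta = n' g give n theta = n' T, so incommensurability forces n = 0 and T =
       0. *)
    assert (Hn0 : n = 0%Z) by (apply (Hinc n n'); rewrite Hn, Hn'; ring).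
    rewrite Hn, Hn0 in hT; lra.
destruct Hsmall as [g [[k [m Hg]] [hg hge]]].
destruct (euclidean_quotient beta g hg) as [n [h1 h2]].
exists (n * k)%Z, (n * m)%Z; rewrite !mult_IZR.
replace (IZR n * IZR k * theta + IZR n * IZR m * T) with (IZR n * g) by (rewrite Hg; ring).
apply Rabs_lt_between; lra.
Qed.

(** A half-open interval of length l contains exactly one term of the progression; reducing c modulo
    l lists the q terms in [0, q l). *)
Lemma touches_progression (X : R -> C) (c l rho : R) (q : nat) :
  0 < l ->
  (forall s, Cmod (X s) = rho <-> exists k : Z, s = c + IZR k * l) ->
  touches X (INR q * l) rho q.
Proof.
intros hl H.
destruct (euclidean_quotient c l hl) as [k0 hc].
set (c0 := c - IZR k0 * l) in *.
assert (H' : forall s, Cmod (X s) = rho <-> exists k : Z, s = c0 + IZR k * l).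
  intros s; rewrite H; unfold c0; split; intros [k ->].
  - exists (k + k0)%Z; rewrite plus_IZR; ring.
  - exists (k - k0)%Z; rewrite minus_IZR; ring.
exists (map (fun i => c0 + INR i * l) (seq 0 q)); split; [| split].
- apply Injective_map_NoDup; [| apply seq_NoDup].
  intros i j Hij; apply INR_eq, Rmult_eq_reg_r with l; lra.
- now rewrite length_map, length_seq.
- intros s; rewrite H', in_map_iff; split.
  + intros [i [<- Hi]]; apply in_seq in Hi.
    pose proof (pos_INR i).
    assert (INR (S i) <= INR q) by (apply le_INR; lia).
    rewrite S_INR in *; split; [nra |].
    exists (Z.of_nat i); now rewrite <- INR_IZR_INZ.
  + intros [hs [k ->]].
    assert (hk : (-1 < k)%Z) by (apply lt_IZR, Rmult_lt_reg_r with l; lra).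
    assert (hq : (k < Z.of_nat q)%Z).
      apply lt_IZR; rewrite <- INR_IZR_INZ; apply Rmult_lt_reg_r with l; lra.
    exists (Z.to_nat k); rewrite INR_IZR_INZ, Z2Nat.id by lia.
    split; [reflexivity | apply in_seq; lia].
Qed.

Lemma annulus_radii_unique (X : R -> C) (a b a' b' : R) :
  annulus_radii X a b -> annulus_radii X a' b' -> a = a' /\ b = b'.
Proof.
intros [H [[s1 H1] [s2 H2]]] [H' [[s1' H1'] [s2' H2']]].
pose proof (H s1'); pose proof (H s2'); pose proof (H' s1); pose proof (H' s2).
split; lra.
Qed.

Lemma expi_lipschitz (s t : R) : Cmod (expi s - expi t)%C <= 2 * Rabs (s - t).
Proof.
assert (Hlip : forall f df : R -> R, (forall x, is_derive f x (df x)) ->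
    (forall x, -1 <= df x <= 1) -> forall x y, Rabs (f x - f y) <= Rabs (x - y)).
  assert (Hle : forall f df : R -> R, (forall x, is_derive f x (df x)) ->
      (forall x, -1 <= df x <= 1) -> forall x y, y <= x -> Rabs (f x - f y) <= Rabs (x - y)).
    intros f df Hd Hb x y h.
    pose proof (derive_le_slope f df y x 1 h (fun u _ => Hd u) (fun u _ => proj2 (Hb u))).
    pose proof (derive_ge_slope f df y x (-1) h (fun u _ => Hd u) (fun u _ => proj1 (Hb u))).
    rewrite (Rabs_pos_eq (x - y)) by lra; apply Rabs_le; lra.
  intros f df Hd Hb x y; destruct (Rle_or_lt y x) as [h | h].
    now apply (Hle f df).
  rewrite Rabs_minus_sym, (Rabs_minus_sym x); apply (Hle f df); auto; lra.
assert (Hc : Rabs (cos s - cos t) <= Rabs (s - t)).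
  apply (Hlip cos (fun x => - sin x)); [apply is_derive_cos |].
  intros x; pose proof (SIN_bound x); lra.
assert (Hs : Rabs (sin s - sin t) <= Rabs (s - t)).
  apply (Hlip sin cos); [apply is_derive_sin | intros x; apply COS_bound].
apply Rsqr_incr_0_var; [| pose proof (Rabs_pos (s - t)); lra].
rewrite !Rsqr_pow2, Cmod_sq, Rpow_mult_distr, <- (pow2_abs (Re _)), <- (pow2_abs (Im _)).
simpl Re; simpl Im.
pose proof (Rabs_pos (cos s + - cos t)); pose proof (Rabs_pos (sin s + - sin t)).
unfold Rminus in *; nra.
Qed.

Lemma unit_speed_continuous (X : R -> C) (z : C) (s : R) :
  unit_speed X -> continuity_pt (fun s => Cmod (X s - z)%C) s.
Proof.
intros [HX _]; destruct (HX 1%nat s) as [Hx Hy].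
apply continuity_pt_filterlim.
apply (continuous_comp
  (fun s => (Re (X s) - Re z) ^ 2 + (Im (X s) - Im z) ^ 2) sqrt); [| apply continuous_sqrt].
apply (@ex_derive_continuous R_AbsRing R_NormedModule).
set (x := fun u => Re (X u)) in *; set (y := fun u => Im (X u)) in *.
change (ex_derive (fun s => (x s - Re z) ^ 2 + (y s - Im z) ^ 2) s).
clearbody x y; auto_derive; repeat split; assumption.
Qed.

Lemma Z_of_nat_gcd (a b : nat) :
  Z.gcd (Z.of_nat a) (Z.of_nat b) = Z.of_nat (Nat.gcd a b).
Proof.
apply Z.gcd_unique; [lia | | |].
- destruct (Nat.gcd_divide_l a b) as [c Hc]; exists (Z.of_nat c); lia.
- destruct (Nat.gcd_divide_r a b) as [c Hc]; exists (Z.of_nat c); lia.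
- intros q [u Hu] [v Hv]; destruct (Nat.eq_dec a 0) as [-> | ha].
    now exists v.
  destruct (Nat.gcd_bezout_pos a b ltac:(lia)) as [x [y H]].
  exists (Z.of_nat x * u - Z.of_nat y * v)%Z; nia.
Qed.

Section Closed.

Context (r A t0 alpha : R) (hr : 0 < r) (hA0 : 0 < A).

Let hA : 0 <= A := Rlt_le _ _ hA0.
Let X := model r A t0 alpha.
Let l := arc_period A / r.

Let hl : 0 < l.
Proof. apply Rdiv_lt_0_compat; [apply arc_period_pos | exact hr]. Qed.

Let X_nonzero (s : R) : X s <> RtoC 0.
Proof.
intros H; pose proof (proj1 (proj1 (model_annulus r A hr hA t0 alpha) s)) as Hi.
fold X in Hi; rewrite H, Cmod_0 in Hi.
pose proof (inner_radius_pos r A hr); lra.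
Qed.

(** A period carries an inner time to an inner time, so it is k excursions long. These act as the
    rotation by k Theta, which must be trivial because X is never 0. *)
Lemma model_period_iff (L : R) :
  period X L <->
  exists k m : Z, (0 < k)%Z /\ L = IZR k * l /\ IZR k * turning A = IZR m * (2 * PI).
Proof.
pose proof (model_inner_times r A hr hA t0 alpha hA0) as Hin; fold X l in Hin.
split.
- intros [hL HL].
  set (si := (arc A (- (PI / 2)) - t0) / r) in *.
  destruct (proj1 (Hin (si + L))) as [k Hk].
    rewrite HL; apply Hin; exists 0%Z; ring.
  assert (HLk : L = IZR k * l) by lra.
  destruct (expi_eq_1 (IZR k * turning A)) as [m Hm].
    pose proof (model_shift r A hr hA t0 alpha si k) as Hs; fold X l in Hs.
    rewrite <- HLk, HL in Hs.
    replace (expi (IZR k * turning A))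
      with (expi (IZR k * turning A) * X si / X si)%C by (field; apply X_nonzero).
    rewrite <- Hs; field; apply X_nonzero.
  exists k, m; split; [| now split].
  apply lt_IZR, Rmult_lt_reg_r with l; lra.
- intros [k [m [hk [-> Hm]]]]; split.
    apply Rmult_lt_0_compat; [now apply IZR_lt | exact hl].
  intros s; unfold l, X; rewrite model_shift, Hm by assumption.
  replace (IZR m * (2 * PI)) with (0 + IZR m * (2 * PI)) by ring.
  rewrite expi_period_Z; unfold expi; rewrite cos_0, sin_0; apply Cmult_1_l.
Qed.

Lemma model_closed_of_type (p q : nat) :
  (0 < q)%nat -> Nat.gcd p q = 1%nat -> INR q * turning A = INR p * (2 * PI) ->
  exists L rmin rmax, minimal_period X L /\ rotation_number X L (INR p) /\
    annulus_radii X rmin rmax /\ touches X L rmin q /\ touches X L rmax q.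
Proof.
intros hq Hg Ht; pose proof PI_RGT_0 as hPI.
exists (INR q * l), (inner_radius r A), (outer_radius r A).
split; [split |].
- apply model_period_iff; exists (Z.of_nat q), (Z.of_nat p).
  rewrite <- !INR_IZR_INZ; repeat split; [lia | exact Ht].
- intros L' HL'; apply model_period_iff in HL'.
  destruct HL' as [k [m [hk [-> Hm]]]].
  apply Rmult_le_compat_r; [lra |]; rewrite INR_IZR_INZ; apply IZR_le.
  apply Z.divide_pos_le; [exact hk |].
  (* k Theta = 2 PI m and q Theta = 2 PI p give k p = m q, so q, being prime to p, divides k. *)
  apply (Z.gauss _ (Z.of_nat p)).
  + exists m; apply eq_IZR; rewrite !mult_IZR, <- !INR_IZR_INZ.
    apply Rmult_eq_reg_r with (2 * PI); [| lra].
    transitivity (IZR k * (INR p * (2 * PI))); [ring | rewrite <- Ht].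
    transitivity (INR q * (IZR k * turning A)); [ring | rewrite Hm; ring].
  + now rewrite Z.gcd_comm, Z_of_nat_gcd, Hg.
- split; [| split; [now apply model_annulus | split]].
  + exists (model_angle r A t0 alpha); split; [| split].
    * intros s.
      apply (is_derive_continuous _ _ (r * sol_h A (r * s + t0))).
      pose proof (sol_theta_derive A hA (r * s + t0)) as H.
      unfold model_angle; auto_derive; [eexists; apply H |]; rewrite_Derive H; ring.
    * intros s; rewrite tangent_unit_speed by now apply model_unit_speed.
      now apply model_velocity.
    * unfold model_angle.
      replace (r * (INR q * l) + t0) with (r * 0 + t0 + IZR (Z.of_nat q) * arc_period A)
        by (rewrite <- INR_IZR_INZ; unfold l; field; lra).
      rewrite (quasi_period_Z (sol_theta A) (arc_period A) (turning A))
        by (intros; now apply sol_theta_period).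
      rewrite <- INR_IZR_INZ, Ht; ring.
  + eapply touches_progression; [exact hl | now apply model_inner_times].
  + eapply touches_progression; [exact hl | now apply model_outer_times].
Qed.

(** p / q is m / k in lowest terms for a period of k excursions with k Theta = 2 PI m; the bounds on
    Theta place it in the required interval. *)
Lemma model_closed_admissible (L : R) :
  period X L ->
  exists p q : nat, admissible p q /\ INR q * turning A = INR p * (2 * PI).
Proof.
intros HL; apply model_period_iff in HL; destruct HL as [k [m [hk [_ Hm]]]].
pose proof PI_RGT_0 as hPI.
pose proof (turning_gt_PI A hA0) as h1; pose proof (turning_lt_sqrt2_PI A hA0) as h2.
assert (hk' := IZR_lt _ _ hk).
assert (hm : (0 < m)%Z) by (apply lt_IZR, Rmult_lt_reg_r with (2 * PI); nra).
set (g := Z.gcd m k).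
assert (hg : (0 < g)%Z).
  pose proof (Z.gcd_nonneg m k) as hg; fold g in hg.
  enough (g <> 0)%Z by lia; intros Hg; apply Z.gcd_eq_0_l in Hg; lia.
destruct (Z.gcd_divide_l m k) as [p Hp]; destruct (Z.gcd_divide_r m k) as [q Hq].
fold g in Hp, Hq.
assert (hp : (0 < p)%Z) by nia; assert (hq : (0 < q)%Z) by nia.
assert (Hgcd : Z.gcd p q = 1%Z).
  pose proof (Z.gcd_div_gcd m k g ltac:(lia) eq_refl) as H.
  rewrite Hp, Hq, !Z.div_mul in H by lia; exact H.
assert (Ht : IZR q * turning A = IZR p * (2 * PI)).
  apply Rmult_eq_reg_l with (IZR g); [| apply not_0_IZR; lia].
  rewrite Hp, Hq, !mult_IZR in Hm; lra.
assert (hq' := IZR_lt _ _ hq).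
exists (Z.to_nat p), (Z.to_nat q); unfold admissible.
rewrite !INR_IZR_INZ, !Z2Nat.id by lia; split; [| exact Ht].
split; [lia | split; [lia | split]].
- apply Nat2Z.inj; rewrite <- Z_of_nat_gcd, !Z2Nat.id by lia; exact Hgcd.
- assert (Hpq : IZR p / IZR q = turning A / (2 * PI)).
    apply Rmult_eq_reg_r with (IZR q * (2 * PI)); [| nra].
    field_simplify; [| lra | lra]; lra.
  rewrite Hpq; split; apply Rmult_lt_reg_r with (2 * PI); try lra; field_simplify; lra.
Qed.

(** The curve meets every circle of the annulus. Moving on by k excursions rotates the meeting point
    by k Theta, and these angles are dense modulo 2 PI. *)
Lemma model_dense : ~ closed_curve X -> dense_in_annulus X.
Proof.
intros Hnc.
exists (inner_radius r A), (outer_radius r A); split; [now apply model_annulus |].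
intros z hz eps heps.
destruct (radius_onto r A hr hA (Cmod z) hz) as [y [hy Hy]].
assert (hs : -1 <= y / A <= 1).
  split; apply Rmult_le_reg_r with A; try lra; field_simplify; lra.
set (s1 := (arc A (asin (y / A)) - t0) / r).
assert (Hs1 : Cmod (X s1) = Cmod z).
  unfold X, s1; rewrite model_radius, psi_at, sin_asin, <- Hy by assumption.
  f_equal; field; lra.
destruct (polar_form z) as [u Hu]; destruct (polar_form (X s1)) as [v Hv].
pose proof (inner_radius_pos r A hr) as hi.
assert (hz0 : 0 < Cmod z) by lra.
destruct (kronecker_density (turning A) (2 * PI)) with (beta := u - v)
  (* The divisor accounts for the radius of the circle and the constant 2 of [expi_lipschitz]. *)
  (eps := eps / (2 * Cmod z)) as [k [m Hkm]].
- pose proof PI_RGT_0; lra.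
- assert (Hpos : forall k m : Z, (0 < k)%Z -> IZR k * turning A <> IZR m * (2 * PI)).
    intros k m hk H; apply Hnc; exists (IZR k * l); apply model_period_iff.
    exists k, m; auto.
  intros k m H; destruct (Z.lt_trichotomy k 0) as [h | [h | h]]; [| exact h |].
  + exfalso; apply (Hpos (- k)%Z (- m)%Z); [lia | rewrite !opp_IZR; lra].
  + exfalso; now apply (Hpos k m).
- apply Rdiv_lt_0_compat; lra.
- exists (s1 + IZR k * l); unfold X, l; rewrite model_shift by assumption; fold X.
  rewrite Hv, Hs1; set (rho := Cmod z) in *; clearbody rho; rewrite Hu.
  rewrite <- (expi_period_Z (IZR k * turning A) m).
  replace (_ - _)%C with
    (RtoC rho * (expi (IZR k * turning A + IZR m * (2 * PI) + v) - expi u))%C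
    by (rewrite expi_plus; ring).
  rewrite Cmod_mult, Cmod_R, Rabs_pos_eq by lra.
  apply Rle_lt_trans with
    (rho * (2 * (Rabs (IZR k * turning A + IZR m * (2 * PI) - (u - v))))).
  + apply Rmult_le_compat_l; [lra |].
    replace (IZR k * turning A + IZR m * (2 * PI) - (u - v))
      with (IZR k * turning A + IZR m * (2 * PI) + v - u) by ring.
    apply expi_lipschitz.
  + apply Rmult_lt_reg_r with (/ (2 * rho)); [apply Rinv_0_lt_compat; lra |].
    unfold Rdiv in Hkm; field_simplify; [| lra | lra]; lra.
Qed.

(* The points on the outer circle are permuted by the finite group of rotations
   carrying a closed curve to itself, so they cannot fill the circle. *)
Lemma model_closed_not_dense : closed_curve X -> ~ dense_in_annulus X.
Proof.
intros [L HL] [rmin [rmax [Hann Hdense]]].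
destruct (annulus_radii_unique _ _ _ _ _ Hann (model_annulus r A hr hA t0 alpha)) as [-> ->].
pose proof (proj1 (model_period_iff L) HL) as [k [m [hk [HLk Hm]]]].
assert (hk' := IZR_lt _ _ hk).
set (so := (arc A (PI / 2) - t0) / r).
pose proof (model_outer_times r A hr hA t0 alpha hA0) as Hout; fold X l so in Hout.
assert (Hso : Cmod (X so) = outer_radius r A) by (apply Hout; exists 0%Z; ring).
(* The rotations j Theta are multiples of 2 PI / k modulo 2 PI; PI / k is half a step, so z should
   be missed by the curve. *)
set (z := (expi (PI / IZR k) * X so)%C).
assert (Hz : Cmod z = outer_radius r A)
  by (unfold z; rewrite Cmod_mult, Cmod_expi, Hso; ring).
pose proof (inner_lt_outer r A hr hA0) as hio.
specialize (Hdense z ltac:(lra)).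
destruct HL as [hL HL].
(* The distance to z attains its minimum over one period; density makes it 0, so z would lie on the
   curve. *)
destruct (continuity_ab_min (fun s => Cmod (X s - z)%C) 0 L) as [sm [Hmin _]]; [lra | |].
  intros c _; apply unit_speed_continuous; now apply model_unit_speed.
assert (Hsm : X sm = z).
  destruct (Rle_lt_or_eq_dec 0 _ (Cmod_ge_0 (X sm - z)%C)) as [h | h].
  - exfalso; destruct (Hdense _ h) as [s Hs].
    destruct (euclidean_quotient s L hL) as [n hn].
    assert (Hper : X (s - IZR n * L) = X s).
      replace s with (s - IZR n * L + IZR n * L) at 2 by ring.
      symmetry; clear - HL; generalize (s - IZR n * L); clear s.
      intros s; apply injective_projections.
      + rewrite (quasi_period_Z (fun s => fst (X s)) L 0); [ring |].
        intros x; rewrite HL; ring.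
      + rewrite (quasi_period_Z (fun s => snd (X s)) L 0); [ring |].
        intros x; rewrite HL; ring.
    specialize (Hmin (s - IZR n * L) ltac:(lra)); rewrite Hper in Hmin; lra.
  - symmetry in h; apply Cmod_eq_0 in h.
    replace (X sm) with (X sm - z + z)%C by ring; rewrite h; ring.
destruct (proj1 (Hout sm)) as [j Hj]; [now rewrite Hsm |].
pose proof (model_shift r A hr hA t0 alpha so j) as Hs; fold X l in Hs.
rewrite <- Hj, Hsm in Hs; unfold z in Hs.
assert (He : expi (IZR j * turning A) = expi (PI / IZR k)).
  replace (expi (IZR j * turning A)) with (expi (IZR j * turning A) * X so / X so)%C
    by (field; apply X_nonzero).
  rewrite <- Hs; field; apply X_nonzero.
apply expi_eq in He; destruct He as [n Hn].
pose proof PI_RGT_0.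
(* j Theta = PI / k + 2 PI n, multiplied by k and divided by PI: an even number equals an odd
   one. *)
assert (Hodd : IZR (2 * (j * m)) = IZR (1 + 2 * (n * k))).
  rewrite plus_IZR, !mult_IZR; apply Rmult_eq_reg_r with PI; [| lra].
  transitivity (IZR j * (IZR m * (2 * PI))); [ring | rewrite <- Hm].
  transitivity (IZR k * (IZR j * turning A)); [ring | rewrite Hn; field; lra].
apply eq_IZR in Hodd; lia.
Qed.

End Closed.

(** * The circle, reversal of orientation, and the flow *)

Section Circle.

Context (r t0 alpha : R) (hr : 0 < r).

Let X := model r 0 t0 alpha.

Let X_eq : exists c, forall s, X s = (RtoC (/ r) * expi (r * s + c))%C.
Proof.
assert (Hh : forall t, sol_h 0 t = 1)
  by (intros t; unfold sol_h; now rewrite Rmult_0_l, zeta_0, exp_0).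
assert (Ht : forall t, sol_theta 0 t - t = sol_theta 0 0 - 0).
  intros t; apply (derive_0_const (fun t => sol_theta 0 t - t)); clear t; intros t.
  pose proof (sol_theta_derive 0 (Rle_refl 0) t) as H; rewrite Hh in H.
  auto_derive; [now eexists; apply H |]; rewrite_Derive H; ring.
(* With h = 1 and sigma = 0 the model is - N / r, and - N is the tangent turned back by PI / 2. *)
exists (t0 + sol_theta 0 0 + alpha - PI / 2); intros s.
unfold X, model, model_angle, sol_sigma; rewrite Hh.
replace (sol_theta 0 (r * s + t0)) with (r * s + t0 + sol_theta 0 0)
  by (specialize (Ht (r * s + t0)); lra).
replace (r * s + (t0 + sol_theta 0 0 + alpha - PI / 2))
  with (- (PI / 2 - (r * s + t0 + sol_theta 0 0 + alpha))) by ring.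
unfold expi; rewrite cos_neg, sin_neg, cos_shift, sin_shift.
apply injective_projections; simpl; ring.
Qed.

Lemma model_circle : circle_at_origin (1 / r) X.
Proof.
destruct X_eq as [c Hc]; intros z; split.
- intros [s <-]; rewrite Hc, Cmod_mult, Cmod_expi, Cmod_R, Rabs_pos_eq.
    field; lra.
  left; now apply Rinv_0_lt_compat.
- intros Hz; destruct (polar_form z) as [t Ht]; exists ((t - c) / r).
  rewrite Hc, Ht, Hz; unfold Rdiv; rewrite Rmult_1_l; do 2 f_equal; field; lra.
Qed.

Lemma model_circle_closed : closed_curve X.
Proof.
destruct X_eq as [c Hc]; exists (2 * PI / r); split.
- pose proof PI_RGT_0; apply Rdiv_lt_0_compat; lra.
- intros s; rewrite !Hc, <- (expi_period_Z (r * s + c) 1); do 2 f_equal; field; lra.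
Qed.

End Circle.

(** * Invariance under reversal of orientation *)

Lemma annulus_radii_reverse (X : R -> C) (a b : R) :
  annulus_radii X a b -> annulus_radii (reverse X) a b.
Proof.
unfold reverse; intros [H [[s1 H1] [s2 H2]]]; split; [intros s; apply H | split].
- exists (- s1); now rewrite Ropp_involutive.
- exists (- s2); now rewrite Ropp_involutive.
Qed.

Lemma circle_at_origin_reverse (X : R -> C) (rho : R) :
  circle_at_origin rho X -> circle_at_origin rho (reverse X).
Proof.
intros H z; rewrite <- (H z); unfold reverse; split; intros [s Hs]; exists (- s);
  now rewrite ?Ropp_involutive.
Qed.

Lemma closed_curve_reverse (X : R -> C) : closed_curve X -> closed_curve (reverse X).
Proof.
intros [L [hL HL]]; exists L; split; [exact hL |]; intros s; unfold reverse.
rewrite <- (HL (- (s + L))); f_equal; ring.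
Qed.

Lemma dense_in_annulus_reverse (X : R -> C) :
  dense_in_annulus X -> dense_in_annulus (reverse X).
Proof.
intros [a [b [Hann H]]]; exists a, b; split; [now apply annulus_radii_reverse |].
intros z hz eps heps; destruct (H z hz eps heps) as [s Hs].
exists (- s); unfold reverse; now rewrite Ropp_involutive.
Qed.

Lemma identical_excursions_reverse (X : R -> C) (a b : R) :
  identical_excursions X a b -> identical_excursions (reverse X) a b.
Proof.
intros [s0 [l [w [hl [hw [Hex Hw]]]]]].
exists (- s0), l, (Cconj w).
split; [exact hl | split; [now rewrite Cmod_conj | split]].
(* Under s -> - s the interval with index - j - 1 becomes the one with index j, and its two ends are
   exchanged. *)
- intros j; destruct (Hex (- j - 1)%Z) as [m [hm [H1 [H2 [H3 H4]]]]].
  rewrite minus_IZR, opp_IZR in *.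
  exists (- m); unfold reverse; rewrite !Ropp_involutive.
  split; [lra |].
  split; [rewrite <- H3; do 2 f_equal; ring |].
  split; [exact H2 |].
  split; [rewrite <- H1; do 2 f_equal; ring |].
  intros s hs hne; apply H4; lra.
- intros s; unfold reverse.
  replace (- s) with (- (s + l) + l) by ring; rewrite Hw.
  assert (Hww : (Cconj w * w)%C = RtoC 1).
    pose proof (Cmod_sq w) as H; rewrite hw in H.
    apply injective_projections; simpl; unfold Re, Im in H; lra.
  rewrite Cmult_assoc, Hww; ring.
Qed.

Section Oriented.

Context (r A t0 alpha : R) (hr : 0 < r) (hA : 0 <= A) (X : R -> C).

Let M := model r A t0 alpha.

Context (HX : X = M \/ X = reverse M).

Let M_pos : positively_curved M.
Proof. now apply (model_pos_shrinker r A t0 alpha). Qed.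

Let M_unit_speed : unit_speed M.
Proof. now apply model_unit_speed. Qed.

Lemma oriented_positive : positive_orientation X M.
Proof.
split; [| exact M_pos].
destruct HX as [-> | ->]; [now left | right; now rewrite reverse_reverse].
Qed.

Lemma oriented_positive_unique (Y : R -> C) : positive_orientation X Y -> Y = M.
Proof.
assert (Hrev : ~ positively_curved (reverse M)).
  intros H; specialize (H 0); rewrite curvature_reverse in H by exact M_unit_speed.
  pose proof (M_pos (- 0)); lra.
intros [HY Hpos]; destruct HX as [-> | ->]; destruct HY as [-> | ->]; try easy.
apply reverse_reverse.
Qed.

Lemma oriented_curvature_sign :
  (forall s, 0 < curvature X s) \/ (forall s, curvature X s < 0).
Proof.
destruct HX as [-> | ->]; [left; exact M_pos | right].
intros s; rewrite curvature_reverse by exact M_unit_speed.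
pose proof (M_pos (- s)); lra.
Qed.

Lemma oriented_annulus : annulus_radii X (inner_radius r A) (outer_radius r A).
Proof.
destruct HX as [-> | ->]; [| apply annulus_radii_reverse]; now apply model_annulus.
Qed.

Lemma oriented_curvature_increasing :
  curvature_increasing M (inner_radius r A) (outer_radius r A).
Proof.
(* The curvature is r h, with conservation of energy solved for h in terms of the radius. *)
exists (fun rho => r * exp (((r * rho) ^ 2 - A ^ 2 - 1) / 2)); split.
- intros r1 r2 h1 h2 _; pose proof (inner_radius_pos r A hr).
  apply Rmult_lt_compat_l; [exact hr |]; apply exp_increasing.
  assert (r * r1 < r * r2) by nra; assert (0 < r * r1) by nra; nra.
- intros s; unfold M; rewrite model_curvature, model_radius by assumption.
  unfold sol_h, radius; do 2 f_equal.
  replace (r * (sqrt (A ^ 2 + 1 + 2 * zeta (A * sin (phase A (r * s + t0)))) / r))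
    with (sqrt (A ^ 2 + 1 + 2 * zeta (A * sin (phase A (r * s + t0))))) by (field; lra).
  rewrite pow2_sqrt; [field |].
  left; apply radicand_pos; pose proof (A_sin_bound A (phase A (r * s + t0)) hA); lra.
Qed.

Lemma oriented_closed_of_type (p q : nat) :
  0 < A -> admissible p q -> INR q * turning A = INR p * (2 * PI) -> closed_of_type X p q.
Proof.
intros hA0 [_ [hq [hg _]]] Ht.
destruct (model_closed_of_type r A t0 alpha hr hA0 p q hq hg Ht)
  as [L [rmin [rmax [H1 [H2 [H3 [H4 H5]]]]]]].
exists M, L, rmin, rmax; split; [apply oriented_positive |]; auto.
Qed.

End Oriented.

(** The left-hand side is exp (z - h ^ 2 / 2) / r, and the energy at y = A or y = - A is h ^ 2 - 2 z
    = A ^ 2 + 1. The common value gives the relation between the two radii. *)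
Lemma radius_weight (r A y : R) :
  0 < r -> y ^ 2 = A ^ 2 ->
  exp (zeta y) / r * exp (- r ^ 2 * (exp (zeta y) / r) ^ 2 / 2) =
  exp (- (A ^ 2 + 1) / 2) / r.
Proof.
intros hr hy; pose proof (zeta_energy y) as H; rewrite exp_zeta_double in H.
replace (- r ^ 2 * (exp (zeta y) / r) ^ 2 / 2) with (- exp (zeta y) ^ 2 / 2) by (field; lra).
unfold Rdiv at 1; rewrite Rmult_assoc, (Rmult_comm (/ r)), <- Rmult_assoc, <- exp_plus.
replace (zeta y + _) with (- (A ^ 2 + 1) / 2) by lra; reflexivity.
Qed.

(** * The two radii as functions of A, and congruence of curves with the same A *)

Lemma exp_nondecreasing (x y : R) : x <= y -> exp x <= exp y.
Proof. intros [h | ->]; [left; now apply exp_increasing | lra]. Qed.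

Lemma inner_radius_le (r A : R) : 0 < r -> 0 <= A -> inner_radius r A <= 1 / r.
Proof.
intros hr hA; apply Rmult_le_compat_r; [left; now apply Rinv_0_lt_compat |].
rewrite <- exp_0, <- zeta_0; apply exp_nondecreasing, zeta_nondecreasing; lra.
Qed.

Lemma outer_radius_ge (r A : R) : 0 < r -> 0 <= A -> 1 / r <= outer_radius r A.
Proof.
intros hr hA; apply Rmult_le_compat_r; [left; now apply Rinv_0_lt_compat |].
rewrite <- exp_0, <- zeta_0; apply exp_nondecreasing, zeta_nondecreasing; lra.
Qed.

Lemma inner_radius_onto (r rho : R) :
  0 < r -> 0 < rho <= 1 / r -> exists A, 0 <= A /\ inner_radius r A = rho.
Proof.
intros hr [h1 h2].
assert (h3 : 0 < r * rho) by nra.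
assert (h4 : r * rho <= 1).
  apply (Rmult_le_compat_l r) in h2; [| lra].
  replace (r * (1 / r)) with 1 in h2 by (field; lra); exact h2.
exists (- amp (ln (r * rho))); split.
- assert (Hl : ln (r * rho) <= 0) by (rewrite <- ln_1; apply ln_le; lra).
  destruct Hl as [Hl | ->]; [pose proof (amp_neg _ Hl); lra | rewrite amp_0; lra].
- unfold inner_radius; rewrite Ropp_involutive, zeta_amp, exp_ln by exact h3.
  field; lra.
Qed.

Lemma outer_radius_onto (r rho : R) :
  0 < r -> 1 / r <= rho -> exists A, 0 <= A /\ outer_radius r A = rho.
Proof.
intros hr h2.
assert (h4 : 1 <= r * rho).
  apply (Rmult_le_compat_l r) in h2; [| lra].
  replace (r * (1 / r)) with 1 in h2 by (field; lra); exact h2.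
exists (amp (ln (r * rho))); split.
- assert (Hl : 0 <= ln (r * rho)) by (rewrite <- ln_1; apply ln_le; lra).
  destruct Hl as [Hl | <-]; [pose proof (amp_pos _ Hl); lra | rewrite amp_0; lra].
- unfold outer_radius; rewrite zeta_amp, exp_ln by lra.
  field; lra.
Qed.

Lemma inner_radius_inj (r A A' : R) :
  0 < r -> inner_radius r A = inner_radius r A' -> A = A'.
Proof.
intros hr H; unfold inner_radius in H; apply Rmult_eq_reg_r in H;
  [| apply Rinv_neq_0_compat; lra].
apply exp_inv in H; destruct (Rtotal_order A A') as [h | [h | h]]; [| exact h |].
- pose proof (zeta_increasing (- A') (- A)); lra.
- pose proof (zeta_increasing (- A) (- A')); lra.
Qed.

Lemma model_shift_rotate (r A t0 alpha t0' alpha' s : R) :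
  0 < r ->
  model r A t0' alpha' s =
  (expi (alpha' - alpha) * model r A t0 alpha (s + (t0' - t0) / r))%C.
Proof.
intros hr; unfold model, model_angle, expi.
replace (r * (s + (t0' - t0) / r) + t0) with (r * s + t0') by (field; lra).
set (th := sol_theta A (r * s + t0')).
replace (th + alpha') with (alpha' - alpha + (th + alpha)) by ring.
set (phi := th + alpha); clearbody phi; set (d := alpha' - alpha); clearbody d.
rewrite cos_plus, sin_plus; apply injective_projections; simpl; ring.
Qed.

Lemma oriented_congruent (r A t0 alpha t0' alpha' : R) (X Y : R -> C) :
  0 < r ->
  X = model r A t0 alpha \/ X = reverse (model r A t0 alpha) ->
  Y = model r A t0' alpha' \/ Y = reverse (model r A t0' alpha') ->
  congruent X Y.
Proof.
intros hr HX HY.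
set (w := expi (alpha' - alpha)); set (d := (t0' - t0) / r).
assert (HM : forall s, model r A t0' alpha' s = (w * model r A t0 alpha (s + d))%C)
  by (intros; now apply model_shift_rotate).
assert (hw : Cmod w = 1) by apply Cmod_expi.
destruct HX as [-> | ->]; destruct HY as [-> | ->]; unfold reverse.
- exists w, 1, d; repeat split; [exact hw | now left |].
  intros s; rewrite HM; do 2 f_equal; ring.
- exists w, (-1), d; repeat split; [exact hw | now right |].
  intros s; rewrite HM; do 2 f_equal; ring.
- exists w, (-1), (- d); repeat split; [exact hw | now right |].
  intros s; rewrite HM; do 2 f_equal; ring.
- exists w, 1, (- d); repeat split; [exact hw | now left |].
  intros s; rewrite HM; do 2 f_equal; ring.
Qed.

(** * Homotheties and the curve shortening flow *)

Lemma velocity_scal (g : R) (X : R -> C) (s : R) :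
  velocity (fun u => (RtoC g * X u)%C) s = (RtoC g * velocity X s)%C.
Proof.
unfold velocity; apply injective_projections; simpl.
- rewrite (Derive_ext _ (fun u => g * Re (X u))) by (intros; simpl; unfold Re; ring).
  rewrite Derive_scal; ring.
- rewrite (Derive_ext _ (fun u => g * Im (X u))) by (intros; simpl; unfold Im; ring).
  rewrite Derive_scal; ring.
Qed.

Lemma smooth_scal (g : R) (X : R -> C) : smooth X -> smooth (fun u => (RtoC g * X u)%C).
Proof.
intros HX n s; destruct (HX n s) as [Hx Hy]; split.
- apply (ex_derive_n_ext (fun u => g * Re (X u))); [intros; simpl; unfold Re; ring |].
  now apply ex_derive_n_scal_l.
- apply (ex_derive_n_ext (fun u => g * Im (X u))); [intros; simpl; unfold Im; ring |].
  now apply ex_derive_n_scal_l.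
Qed.

Section Homothety.

Context (g : R) (hg : 0 < g) (X : R -> C) (HX : unit_speed X).

Lemma normal_scal (s : R) : normal (fun u => (RtoC g * X u)%C) s = normal X s.
Proof.
rewrite (normal_unit_speed X) by exact HX; unfold normal, tangent.
rewrite velocity_scal, Cmod_mult, (proj2 HX s), Rmult_1_r, Cmod_R, Rabs_pos_eq by lra.
field; intros H; injection H; lra.
Qed.

Lemma curvature_scal (s : R) :
  curvature (fun u => (RtoC g * X u)%C) s = curvature X s / g.
Proof.
unfold curvature; rewrite normal_scal, velocity_scal, Cmod_mult, (proj2 HX s), Cmod_R.
rewrite Rabs_pos_eq by lra.
replace (velocity (velocity (fun u => (RtoC g * X u)%C)))
  with (velocity (fun u => (RtoC g * velocity X u)%C)).
  rewrite velocity_scal, !inner_eq.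
  generalize (normal X s) (velocity (velocity X) s); intros n v; simpl; unfold Re, Im; field; lra.
f_equal; apply functional_extensionality; intros u; now rewrite velocity_scal.
Qed.

Lemma immersed_scal : immersed (fun u => (RtoC g * X u)%C).
Proof.
split; [apply smooth_scal, HX |]; intros s H.
rewrite velocity_scal in H; apply (f_equal Cmod) in H.
rewrite Cmod_mult, (proj2 HX s), Cmod_R, Cmod_0, Rabs_pos_eq in H by lra; lra.
Qed.

End Homothety.

(** The scaling g satisfies g' = B / g, so the normal speed is (B / g) <X, N> = k / g, the curvature
    of the curve scaled by g. *)
Lemma shrinker_flow (B : R) (X : R -> C) :
  B < 0 -> unit_speed X ->
  (forall s, B * inner (X s) (normal X s) = curvature X s) ->
  curve_shortening_flow X (fun u t => (RtoC (sqrt (2 * B * t + 1)%R) * X u)%C)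
    (- (1 / (2 * B))).
Proof.
intros hB HX HBX; split.
  intros u; rewrite Rmult_0_r, Rplus_0_l, sqrt_1; apply Cmult_1_l.
intros t [_ ht].
assert (hp : 0 < 2 * B * t + 1).
  apply (Rmult_lt_gt_compat_neg_l (2 * B)) in ht; [| lra].
  replace (2 * B * - (1 / (2 * B))) with (-1) in ht by (field; lra); lra.
set (g := sqrt (2 * B * t + 1)).
assert (hg : 0 < g) by now apply sqrt_lt_R0.
split; [now apply immersed_scal |]; intros u.
assert (D : forall c, is_derive (fun t' => sqrt (2 * B * t' + 1) * c) t (B / g * c)).
  intros c; unfold g; auto_derive; [exact hp |]; field; apply Rgt_not_eq, hg.
assert (Dre : is_derive (fun t' => Re (RtoC (sqrt (2 * B * t' + 1)) * X u)%C) t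
    (B / g * Re (X u))).
  apply (is_derive_ext (fun t' => sqrt (2 * B * t' + 1) * Re (X u)));
    [intros; simpl; unfold Re; ring | apply D].
assert (Dim : is_derive (fun t' => Im (RtoC (sqrt (2 * B * t' + 1)) * X u)%C) t
    (B / g * Im (X u))).
  apply (is_derive_ext (fun t' => sqrt (2 * B * t' + 1) * Im (X u)));
    [intros; simpl; unfold Im; ring | apply D].
split; [eexists; apply Dre | split; [eexists; apply Dim |]].
fold g; rewrite normal_scal, curvature_scal, <- HBX by assumption.
replace (velocity _ t) with (B / g * Re (X u), B / g * Im (X u))
  by (symmetry; apply injective_projections; apply is_derive_unique; assumption).
rewrite !inner_eq; generalize (normal X u); intros n; simpl; unfold Rdiv, Re, Im; ring.
Qed.

Lemma homothety_vanishes (B rho : R) (X : R -> C) :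
  B < 0 -> 0 < rho -> (forall s, Cmod (X s) <= rho) ->
  vanishes_at (fun u t => (RtoC (sqrt (2 * B * t + 1)%R) * X u)%C) (- (1 / (2 * B))).
Proof.
intros hB hrho Hb eps heps.
set (e := eps / rho); assert (he : 0 < e) by now apply Rdiv_lt_0_compat.
(* Within this distance of the final time, 2 B t + 1 < e ^ 2. *)
exists (e ^ 2 / (- (2 * B))); split; [apply Rdiv_lt_0_compat; nra |].
intros u t [h1 _].
rewrite Cmod_mult, Cmod_R, Rabs_pos_eq by apply sqrt_pos.
assert (hs : sqrt (2 * B * t + 1) < e).
  rewrite <- (sqrt_pow2 e) by lra.
  apply (Rmult_lt_gt_compat_neg_l (2 * B)) in h1; [| lra].
  replace (2 * B * (- (1 / (2 * B)) - e ^ 2 / - (2 * B))) with (e ^ 2 - 1) in h1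
    by (field; lra).
  destruct (Rle_or_lt 0 (2 * B * t + 1)) as [h | h]; [apply sqrt_lt_1_alt; lra |].
  (* The square root of a negative number is 0 by convention. *)
  rewrite (sqrt_neg_0 (2 * B * t + 1)) by lra; apply sqrt_lt_R0; nra.
apply Rle_lt_trans with (sqrt (2 * B * t + 1) * rho).
- apply Rmult_le_compat_l; [apply sqrt_pos | apply Hb].
- replace eps with (e * rho) by (unfold e; field; lra); nra.
Qed.

(** * The statements for B = - r ^ 2 *)

Section Rescaled_statements.

Context (r : R) (hr : 0 < r).

Lemma shrinker_structure (X : R -> C) :
  shrinker (- r ^ 2) X ->
  exists rmin rmax : R,
    annulus_radii X rmin rmax /\
    0 < rmin <= 1 / r /\ 1 / r <= rmax /\
    rmin * exp (- r ^ 2 * rmin ^ 2 / 2) = rmax * exp (- r ^ 2 * rmax ^ 2 / 2) /\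
    (circle_at_origin (1 / r) X \/ (rmin < rmax /\ identical_excursions X rmin rmax)) /\
    ((forall s, 0 < curvature X s) \/ (forall s, curvature X s < 0)) /\
    (exists Y, positive_orientation X Y) /\
    (forall Y, positive_orientation X Y -> curvature_increasing Y rmin rmax).
Proof.
intros HX; destruct (shrinker_classification r X hr HX) as (A & t0 & alpha & hA & HM).
exists (inner_radius r A), (outer_radius r A).
split; [now apply (oriented_annulus r A t0 alpha) |].
split; [split; [now apply inner_radius_pos | now apply inner_radius_le] |].
split; [now apply outer_radius_ge |].
split; [unfold inner_radius, outer_radius; rewrite !(radius_weight r A); auto; ring |].
split; [| split; [now apply (oriented_curvature_sign r A t0 alpha) | split]].
- destruct hA as [hA | <-].
  + right; split; [now apply inner_lt_outer |].
    destruct HM as [-> | ->]; [| apply identical_excursions_reverse];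
      apply model_excursions; lra.
  + left; destruct HM as [-> | ->]; [| apply circle_at_origin_reverse];
      now apply model_circle.
- exists (model r A t0 alpha); now apply oriented_positive.
- intros Y HY.
  rewrite (oriented_positive_unique r A t0 alpha hr hA X HM Y HY).
  now apply oriented_curvature_increasing.
Qed.

Lemma shrinker_of_inner_radius (rho : R) :
  0 < rho <= 1 / r -> exists X rmax, shrinker (- r ^ 2) X /\ annulus_radii X rho rmax.
Proof.
intros h; destruct (inner_radius_onto r rho hr h) as [A [hA <-]].
exists (model r A 0 0), (outer_radius r A).
split; [now apply model_shrinker | now apply model_annulus].
Qed.

Lemma shrinker_of_outer_radius (rho : R) :
  1 / r <= rho -> exists X rmin, shrinker (- r ^ 2) X /\ annulus_radii X rmin rho.
Proof.
intros h; destruct (outer_radius_onto r rho hr h) as [A [hA <-]].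
exists (model r A 0 0), (inner_radius r A).
split; [now apply model_shrinker | now apply model_annulus].
Qed.

Lemma shrinkers_congruent (rho : R) (X Y : R -> C) (rmaxX rmaxY : R) :
  shrinker (- r ^ 2) X -> annulus_radii X rho rmaxX ->
  shrinker (- r ^ 2) Y -> annulus_radii Y rho rmaxY ->
  congruent X Y.
Proof.
intros HX HaX HY HaY.
destruct (shrinker_classification r X hr HX) as (A & t0 & alpha & hA & HM).
destruct (shrinker_classification r Y hr HY) as (A' & t0' & alpha' & hA' & HM').
pose proof (oriented_annulus r A t0 alpha hr hA X HM) as H.
pose proof (oriented_annulus r A' t0' alpha' hr hA' Y HM') as H'.
destruct (annulus_radii_unique _ _ _ _ _ HaX H) as [e _].
destruct (annulus_radii_unique _ _ _ _ _ HaY H') as [e' _].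
assert (HA : A = A') by (apply (inner_radius_inj r); congruence).
subst A'; now apply (oriented_congruent r A t0 alpha t0' alpha').
Qed.

(** A = 0 is the circle, which fills its degenerate annulus and is dense in it; hence closed curves
    are shown not to be dense only for A > 0. *)
Lemma shrinker_dichotomy (X : R -> C) :
  shrinker (- r ^ 2) X ->
  (closed_curve X /\
     (circle_at_origin (1 / r) X \/
      (~ dense_in_annulus X /\
       exists p q : nat, admissible p q /\ closed_of_type X p q))) \/
  (~ closed_curve X /\ dense_in_annulus X).
Proof.
intros HX; destruct (shrinker_classification r X hr HX) as (A & t0 & alpha & hA & HM).
set (M := model r A t0 alpha) in *.
assert (Hcl : closed_curve X -> closed_curve M).
  intros H; destruct HM as [-> | ->]; [exact H |].
  rewrite <- reverse_reverse; now apply closed_curve_reverse.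
assert (Hcl' : closed_curve M -> closed_curve X).
  intros H; destruct HM as [-> | ->]; [exact H | now apply closed_curve_reverse].
assert (Hd : dense_in_annulus X -> dense_in_annulus M).
  intros H; destruct HM as [-> | ->]; [exact H |].
  rewrite <- reverse_reverse; now apply dense_in_annulus_reverse.
assert (Hd' : dense_in_annulus M -> dense_in_annulus X).
  intros H; destruct HM as [-> | ->]; [exact H | now apply dense_in_annulus_reverse].
destruct hA as [hA | <-].
- destruct (Classical_Prop.classic (closed_curve X)) as [H | H].
  + left; split; [exact H | right; split].
    * intros HdX; now apply (model_closed_not_dense r A t0 alpha hr hA (Hcl H)), Hd.
    * destruct (Hcl H) as [L HL].
      destruct (model_closed_admissible r A t0 alpha hr hA L HL) as (p & q & Hpq & Ht).
      exists p, q; split; [exact Hpq |].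
      apply (oriented_closed_of_type r A t0 alpha hr (Rlt_le _ _ hA) X HM); assumption.
  + right; split; [exact H |].
    apply Hd', model_dense; [assumption | assumption |]; tauto.
- left; split; [now apply Hcl', model_circle_closed | left].
  destruct HM as [-> | ->]; [| apply circle_at_origin_reverse]; now apply model_circle.
Qed.

Lemma circle_shrinker :
  exists X, shrinker (- r ^ 2) X /\ closed_curve X /\ circle_at_origin (1 / r) X.
Proof.
exists (model r 0 0 0); split; [apply model_shrinker; lra |].
split; [now apply model_circle_closed | now apply model_circle].
Qed.

Lemma shrinker_of_type (p q : nat) :
  admissible p q -> exists X, shrinker (- r ^ 2) X /\ closed_of_type X p q.
Proof.
intros Hpq; pose proof Hpq as [_ [hq [_ [h1 h2]]]]; pose proof PI_RGT_0 as hPI.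
assert (hq' : 0 < INR q) by now apply lt_0_INR.
destruct (turning_onto (INR p / INR q * (2 * PI))) as [A [hA Ht]].
  split; [nra |].
  replace (sqrt 2 * PI) with (sqrt 2 / 2 * (2 * PI)) by field.
  apply Rmult_lt_compat_r; lra.
exists (model r A 0 0); split; [apply model_shrinker; lra |].
apply (oriented_closed_of_type r A 0 0 hr (Rlt_le _ _ hA)); try assumption.
- now left.
- rewrite Ht; field; lra.
Qed.

Lemma shrinker_self_similar (X : R -> C) :
  shrinker (- r ^ 2) X ->
  let Xhat := fun u t => (RtoC (sqrt (2 * - r ^ 2 * t + 1)%R) * X u)%C in
  curve_shortening_flow X Xhat (- (1 / (2 * - r ^ 2))) /\
  vanishes_at Xhat (- (1 / (2 * - r ^ 2))).
Proof.
intros HX Xhat.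
destruct (shrinker_structure X HX) as (rmin & rmax & [Hann _] & h1 & h2 & _).
destruct HX as [HX [HB _]].
split; [apply shrinker_flow; auto; nra |].
apply (homothety_vanishes _ rmax); [nra | lra | apply Hann].
Qed.

End Rescaled_statements.

Theorem theorem5p1 (B : R) (hB : B < 0) :
  (* (i) *)
  ((forall X : R -> C, shrinker B X ->
      exists rmin rmax : R,
        annulus_radii X rmin rmax /\
        0 < rmin <= 1 / sqrt (- B) /\ 1 / sqrt (- B) <= rmax /\
        rmin * exp (B * rmin ^ 2 / 2) = rmax * exp (B * rmax ^ 2 / 2) /\
        (circle_at_origin (1 / sqrt (- B)) X \/
         (rmin < rmax /\ identical_excursions X rmin rmax)) /\
        ((forall s, 0 < curvature X s) \/ (forall s, curvature X s < 0)) /\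
        (exists Y, positive_orientation X Y) /\
        (forall Y, positive_orientation X Y ->
           curvature_increasing Y rmin rmax)) /\
   (forall r, 0 < r <= 1 / sqrt (- B) ->
      exists X rmax, shrinker B X /\ annulus_radii X r rmax) /\
   (forall r, 1 / sqrt (- B) <= r ->
      exists X rmin, shrinker B X /\ annulus_radii X rmin r)) /\
  (* (ii) *)
  ((forall r, 0 < r <= 1 / sqrt (- B) ->
      (exists X rmax, shrinker B X /\ annulus_radii X r rmax) /\
      (forall X Y rmaxX rmaxY,
         shrinker B X -> annulus_radii X r rmaxX ->
         shrinker B Y -> annulus_radii Y r rmaxY ->
         congruent X Y)) /\
   (forall X, shrinker B X ->
      (closed_curve X /\
         (circle_at_origin (1 / sqrt (- B)) X \/
          (~ dense_in_annulus X /\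
           exists p q : nat, admissible p q /\ closed_of_type X p q))) \/
      (~ closed_curve X /\ dense_in_annulus X)) /\
   (exists X, shrinker B X /\ closed_curve X /\
      circle_at_origin (1 / sqrt (- B)) X) /\
   (forall p q : nat, admissible p q ->
      exists X, shrinker B X /\ closed_of_type X p q)) /\
  (* (iii) *)
  (forall X, shrinker B X ->
     let Xhat := fun u t => (RtoC (sqrt (2 * B * t + 1)%R) * X u)%C in
     curve_shortening_flow X Xhat (- (1 / (2 * B))) /\
     vanishes_at Xhat (- (1 / (2 * B)))).
Proof.
set (r := sqrt (- B)).
assert (hr : 0 < r) by (apply sqrt_lt_R0; lra).
assert (HB : B = - r ^ 2) by (unfold r; rewrite pow2_sqrt; lra).
clearbody r; subst B.
split; [split; [| split] | split; [split; [| split; [| split]] |]].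
- exact (shrinker_structure r hr).
- exact (shrinker_of_inner_radius r hr).
- exact (shrinker_of_outer_radius r hr).
- intros rho h; split; [now apply shrinker_of_inner_radius |].
  exact (shrinkers_congruent r hr rho).
- exact (shrinker_dichotomy r hr).
- exact (circle_shrinker r hr).
- exact (shrinker_of_type r hr).
- exact (shrinker_self_similar r hr).
Qed.
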